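(* Let $\mathcal{A}$ be a reduced arrangement of $n$ lines in $\mathbb{P}^2$ (over $\mathbb{C}$) and let $d_1,d_2\in\mathbb{Z}_{\geq 0}$ satisfy $d_1+d_2=n-1$. Let $\mathfrak{S}_{\lambda,\beta}(\mathcal{A};d_1,d_2)$ be the penalised Saito functional. For every $\lambda>0$ and $0<\beta<1$: (1) $0\leq \mathfrak{S}_{\lambda,\beta}(\mathcal{A};d_1,d_2)\leq 1$, and the supremum in the definition of $\mathfrak{S}_{\lambda,\beta}(\mathcal{A};d_1,d_2)$ is attained; (2) $\mathfrak{S}_{\lambda,\beta}(\mathcal{A};d_1,d_2)=0$ if and only if $\mathcal{A}$ is free with exponents $(1,d_1,d_2)$; (3) if $\mathcal{A}$ is not free with exponents $(1,d_1,d_2)$, then $0<\mathfrak{S}_{\lambda,\beta}(\mathcal{A};d_1,d_2)<1$; (4) for fixed $(d_1,d_2)$, the functional $\mathcal{A}\mapsto \mathfrak{S}_{\lambda,\beta}(\mathcal{A};d_1,d_2)$ is upper semicontinuous on the ordered reduced configuration space $\mathcal{U}_n$, and it is continuous at every arrangement in $\mathcal{U}_n$ that is free with exponents $(1,d_1,d_2)$; (5) $\mathfrak{S}_{\lambda,\beta}(\mathcal{A};d_1,d_2)$ is nondecreasing in $\lambda$, and $$\lim_{\lambda\to\infty}\mathfrak{S}_{\lambda,\beta}(\mathcal{A};d_1,d_2)=\begin{cases}0,&\mathcal{A}\text{ is free with exponents }(1,d_1,d_2),\\ 1,&\text{otherwise}.\end{cases}$$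
   Context: Let $S=\mathbb{C}[x,y,z]$, let $S_d$ be its space of homogeneous polynomials of degree $d$ (with $S_{-1}=0$), and let $E_d=S_d^{\oplus 3}$. An element $u=(f_0,f_1,f_2)\in E_d$ is identified with the derivation $f_0\partial_x+f_1\partial_y+f_2\partial_z$ of polynomial degree $d$. **Arrangements and freeness.** A reduced arrangement of $n$ lines is a collection $\mathcal{A}=\{L_1,\dots,L_n\}$ of $n$ distinct lines $L_i=V(\alpha_i)\subset\mathbb{P}^2$, with $\alpha_i\in S_1$ nonzero. Its defining polynomial is $Q(\mathcal{A})=\prod_i\alpha_i$. The module of logarithmic derivations is $D(\mathcal{A})=\{\theta\in \operatorname{Der}_{\mathbb{C}}(S):\theta(\alpha_i)\in S\alpha_i\text{ for all }i\}$, graded by polynomial degree. The arrangement $\mathcal{A}$ is free with exponents $(1,d_1,d_2)$ if $D(\mathcal{A})\cong S(-1)\oplus S(-d_1)\oplus S(-d_2)$ as graded $S$-modules, i.e. $D(\mathcal{A})$ is a free $S$-module with a homogeneous basis of polynomial degrees $1,d_1,d_2$ (the order of $d_1,d_2$ is irrelevant). **Norms.** On $S_d$ use the Bombieri–Weyl Hermitian inner product $$\Big\langle \sum_{|\nu|=d}c_\nu x^{\nu_0}y^{\nu_1}z^{\nu_2},\ \sum_{|\nu|=d}c'_\nu x^{\nu_0}y^{\nu_1}z^{\nu_2}\Big\rangle_d=\sum_{|\nu|=d}\frac{c_\nu\overline{c'_\nu}}{\binom{d}{\nu}},\qquad \binom{d}{\nu}=\frac{d!}{\nu_0!\,\nu_1!\,\nu_2!},$$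 with norm $\|\cdot\|_d$; direct sums such as $E_d$ and $S_d^{\oplus n}$ carry the direct-sum inner product and norm. Put $\mathbb{S}(E_d)=\{u\in E_d:\|u\|=1\}$. **Residual operators.** Each defining form $\alpha_i$ is rescaled so that $\|\alpha_i\|_1=1$, and these unit representatives are used throughout, including in $Q(\mathcal{A})=\prod_i\alpha_i$ (the remaining choices of phases and the order of the lines do not affect the functional). For a unit linear form $\alpha=a_0x+a_1y+a_2z$, let $\Pi_{\alpha,d}:S_d\to S_d$ be the orthogonal projector onto $\alpha S_{d-1}$ (so $\Pi_{\alpha,0}=0$). For $u=(f_0,f_1,f_2)\in E_d$ set $$\rho_{\alpha,d}(u)=(I-\Pi_{\alpha,d})(a_0f_0+a_1f_1+a_2f_2),\qquad L_{\mathcal{A},d}(u)=\frac{1}{\sqrt n}\bigl(\rho_{\alpha_1,d}(u),\dots,\rho_{\alpha_n,d}(u)\bigr)\in S_d^{\oplus n}.$$ **Functional.** Let $q_{\mathcal{A}}=Q(\mathcal{A})/\|Q(\mathcal{A})\|_n$. For $u=(f_0,f_1,f_2)\in E_{d_1}$ and $v=(g_0,g_1,g_2)\in E_{d_2}$ with $d_1+d_2=n-1$, let $$B(u,v)=\det\begin{pmatrix}x&y&z\\ f_0&f_1&f_2\\ g_0&g_1&g_2\end{pmatrix}\in S_n,\qquad R_{\mathcal{A}}(u,v)=\|L_{\mathcal{A},d_1}u\|^2+\|L_{\mathcal{A},d_2}v\|^2.$$ For $\lambda>0$, $0<\beta<1$ and $(u,v)\in\mathbb{S}(E_{d_1})\times\mathbb{S}(E_{d_2})$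 let $$\Gamma_{\lambda,\beta,\mathcal{A}}(u,v)=\frac{|\langle B(u,v),q_{\mathcal{A}}\rangle_n|^2}{\|B(u,v)\|_n^2+\lambda R_{\mathcal{A}}(u,v)^\beta}$$ if the denominator is positive, and $\Gamma_{\lambda,\beta,\mathcal{A}}(u,v)=0$ if the denominator is zero. The penalised Saito functional is $$\mathfrak{S}_{\lambda,\beta}(\mathcal{A};d_1,d_2)=1-\sup_{u\in\mathbb{S}(E_{d_1}),\ v\in\mathbb{S}(E_{d_2})}\Gamma_{\lambda,\beta,\mathcal{A}}(u,v).$$ **Configuration space.** $\mathcal{U}_n=\{([\alpha_1],\dots,[\alpha_n])\in(\mathbb{P}(S_1))^n:[\alpha_i]\neq[\alpha_j]\text{ for }i\neq j\}$, with the Euclidean topology inherited from $(\mathbb{P}(S_1))^n$; a point of $\mathcal{U}_n$ is identified with the corresponding (ordered) reduced arrangement of $n$ lines. *)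

(* Defs.v *)
(* MathComp-Analysis.  The complex field is R[i] for an arbitrary R : realType. *)
From HB Require Import structures.
From mathcomp Require Import all_boot all_order all_algebra.
From mathcomp Require Import all_classical all_reals all_analysis.
From mathcomp.real_closed Require Import complex.
(* The notations of mpoly clash with those of mathcomp-analysis. *)
From mathcomp Require Import -(notations) mpoly.

Set Implicit Arguments.
Unset Strict Implicit.
Unset Printing Implicit Defensive.

Import Order.TTheory GRing.Theory Num.Theory numFieldNormedType.Exports.

Local Open Scope classical_set_scope.
Local Open Scope ring_scope.
Local Open Scope quotient_scope.

Notation Spoly R := (mpoly 3 R[i]).

(* u = (f_0, f_1, f_2) stands for the derivation f_0 d/dx + f_1 d/dy + f_2 d/dz. *)
Notation deriv3 R := 'rV[Spoly R]_3.

Section BombieriWeyl.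
Variable R : realType.

Definition homogeneous (d : nat) (p : Spoly R) : bool := p \is ishomog1 d mdeg.

Definition multinomial (m : multinom 3) : nat :=
  ((mdeg m)`! %/ \prod_(i < 3) (m i)`!)%N.

(* [bmultinom 3 d.+1] is the finite type of monomials of degree at most d. *)
Definition bw_dot (d : nat) (p q : Spoly R) : R[i] :=
  \sum_(m : bmultinom 3 d.+1 | mdeg m == d)
     mcoeff m p * (mcoeff m q)^* / (multinomial m)%:R.

Definition bw_norm (d : nat) (p : Spoly R) : R :=
  Num.sqrt (complex.Re (bw_dot d p p)).

Definition bw_dotv (d k : nat) (u v : 'rV[Spoly R]_k) : R[i] :=
  \sum_(j < k) bw_dot d (u 0 j) (v 0 j).

Definition bw_normv (d k : nat) (u : 'rV[Spoly R]_k) : R :=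
  Num.sqrt (complex.Re (bw_dotv d u u)).

Definition E_ (d : nat) : set (deriv3 R) :=
  [set u | forall j, homogeneous d (u 0 j)].

Definition sphereE (d : nat) : set (deriv3 R) :=
  [set u | E_ d u /\ bw_normv d u = 1].

End BombieriWeyl.

Arguments sphereE : clear implicits.

Section ConfigurationSpace.
Variable R : realType.

(* Linear forms are given by their coefficient vectors; R[i]^o is R[i] with
   the topology of its modulus. *)
Definition nonzero_form : set 'rV[R[i]^o]_3 := [set a | a != 0].

Definition proportional (a b : nonzero_form) : bool :=
  `[< exists2 c : R[i], c != 0 & set_val a = c *: set_val b >].

Lemma proportional_refl : reflexive proportional.
Proof. by move=> a; apply/asboolP; exists 1; rewrite ?oner_neq0 ?scale1r. Qed.

Lemma proportional_sym : ssrbool.symmetric proportional.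
Proof.
suff H a b : proportional a b -> proportional b a.
  by move=> a b; apply/idP/idP; exact: H.
move=> /asboolP[c c0 ab]; apply/asboolP; exists c^-1; first by rewrite invr_eq0.
by rewrite ab scalerA mulVf// scale1r.
Qed.

Lemma proportional_trans : transitive proportional.
Proof.
move=> b a c /asboolP[s s0 ab] /asboolP[t t0 bc]; apply/asboolP.
by exists (s * t); rewrite ?mulf_neq0// ab bc scalerA.
Qed.

Canonical proportional_equiv :=
  EquivRel proportional proportional_refl proportional_sym proportional_trans.

(* P(S_1), with the quotient topology *)
Definition projS1 : topologicalType := quotient_topology {eq_quot proportional}.

Definition config (n : nat) : set {ptws 'I_n -> projS1} :=
  [set A | injective (A : 'I_n -> projS1)].

(* [set_type] carries the subspace topology. *)
Definition U_ (n : nat) : topologicalType := set_type (@config n).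

Definition line (n : nat) (A : U_ n) (i : 'I_n) : projS1 := set_val A i.

End ConfigurationSpace.

Section SaitoFunctional.
Variable R : realType.

Definition linform (a : 'rV[R[i]]_3) : Spoly R :=
  \sum_(j < 3) a 0 j *: mpolyX _ (mnm1 j).

(* A unit representative of a point of P(S_1), obtained by rescaling the chosen
   representative [repr P]; its phase plays no role in what follows. *)
Definition unit_form (P : projS1 R) : 'rV[R[i]]_3 :=
  let a : 'rV[R[i]]_3 := set_val (repr P) in
  ((bw_norm 1 (linform a))^-1)%:C%C *: a.

Definition unit_forms (n : nat) (A : U_ R n) (i : 'I_n) : 'rV[R[i]]_3 :=
  unit_form (line A i).

Definition defining_poly (n : nat) (a : 'I_n -> 'rV[R[i]]_3) : Spoly R :=
  \prod_(i < n) linform (a i).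

Definition derivation (u : deriv3 R) (p : Spoly R) : Spoly R :=
  \sum_(j < 3) u 0 j * mderiv j p.

Definition log_derivations (n : nat) (a : 'I_n -> 'rV[R[i]]_3)
    : set (deriv3 R) :=
  [set u | forall i, exists h, derivation u (linform (a i)) = h * linform (a i)].

Definition free_with_exponents (n : nat) (A : U_ R n) (d1 d2 : nat) : Prop :=
  let D := log_derivations (unit_forms A) in
  exists theta : 'I_3 -> deriv3 R,
    [/\ forall k, D (theta k),
        forall k : 'I_3, E_ (nth 0%N [:: 1; d1; d2]%N k) (theta k)
      & forall eta, D eta ->
          exists! c : 'rV[Spoly R]_3, eta = \sum_(k < 3) c 0 k *: theta k].

(* alpha S_{d-1}, where S_{-1} = 0 *)
Definition multiples (alpha : Spoly R) (d : nat) : set (Spoly R) :=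
  if d is e.+1 then [set alpha * q | q in [set q | homogeneous e q]]
  else [set 0].

(* The orthogonal projection onto the subspace W of S_d: the element w of W such
   that f - w is orthogonal to W. *)
Definition orth_proj (d : nat) (W : set (Spoly R)) (f : Spoly R) : Spoly R :=
  xget 0 [set w | W w /\ forall w', W w' -> bw_dot d (f - w) w' = 0].

Definition rho (a : 'rV[R[i]]_3) (d : nat) (u : deriv3 R) : Spoly R :=
  let f := \sum_(j < 3) a 0 j *: u 0 j in
  f - orth_proj d (multiples (linform a) d) f.

Definition residual (n : nat) (a : 'I_n -> 'rV[R[i]]_3) (d : nat)
    (u : deriv3 R) : 'rV[Spoly R]_n :=
  \row_(i < n) (((Num.sqrt n%:R)^-1)%:C%C *: rho (a i) d u).

Definition q_ (n : nat) (a : 'I_n -> 'rV[R[i]]_3) : Spoly R :=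
  ((bw_norm n (defining_poly a))^-1)%:C%C *: defining_poly a.

Definition saito_det (u v : deriv3 R) : Spoly R :=
  \det (\matrix_(k < 3, j < 3)
    nth 0 [:: mpolyX _ (mnm1 j); u 0 j; v 0 j] k).

Definition R_ (n : nat) (a : 'I_n -> 'rV[R[i]]_3) (d1 d2 : nat)
    (u v : deriv3 R) : R :=
  bw_normv d1 (residual a d1 u) ^+ 2 + bw_normv d2 (residual a d2 v) ^+ 2.

Definition Gamma (lambda beta : R) (n : nat) (a : 'I_n -> 'rV[R[i]]_3)
    (d1 d2 : nat) (u v : deriv3 R) : R :=
  let den := bw_norm n (saito_det u v) ^+ 2
             + lambda * (R_ a d1 d2 u v `^ beta) in
  if 0 < den then
    complex.Re `|bw_dot n (saito_det u v) (q_ a)| ^+ 2 / den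
  else 0.

Definition saito (lambda beta : R) (n : nat) (A : U_ R n) (d1 d2 : nat) : R :=
  1 - sup [set Gamma lambda beta (unit_forms A) d1 d2 uv.1 uv.2
          | uv in sphereE R d1 `*` sphereE R d2].

End SaitoFunctional.

Definition upper_semicontinuous (X : topologicalType) (R : realType)
    (f : X -> R) : Prop :=
  forall x a, f x < a -> \forall y \near x, f y < a.

(* Main.v *)
(* For a unit form [a], substituting [X_j - conj(a_j) * linform a] for [X_j] kills
   exactly the multiples of [linform a] and is the orthogonal projection off
   them, because multiplication by [linform a] is adjoint, up to a factor, to
   differentiation along the conjugate of [a].  So the residuals are given by
   polynomials in the coefficients of the forms and their conjugates, and they
   vanish exactly on logarithmic derivations.

   By Saito's criterion the arrangement is free with exponents (1, d1, d2) iff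
   the pairing <B(u, v), q> is nonzero for some logarithmic u, v; then B(u, v)
   is proportional to q and Gamma = 1.  Otherwise the pairing vanishes on pairs
   of logarithmic derivations, hence its square is O(R) by linear algebra, and
   Gamma = O(R^(1 - beta) / lambda): the supremum is then attained on a compact
   set where R is bounded below.  This O(R), together with the boundedness of
   the pairing, also gives Gamma = O(1 / lambda).  Semicontinuity follows by
   moving the lines while keeping a maximizing pair (u, v) fixed. *)

Require Import Defs.
From HB Require Import structures.
From mathcomp Require Import all_boot all_order all_algebra.
From mathcomp Require Import all_classical all_reals all_analysis.
From mathcomp.real_closed Require Import complex.
From mathcomp Require Import -(notations) mpoly.
From mathcomp Require Import ring lra.

Set Implicit Arguments.
Unset Strict Implicit.
Unset Printing Implicit Defensive.

Import Order.TTheory GRing.Theory Num.Theory numFieldNormedType.Exports.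

Local Open Scope classical_set_scope.
Local Open Scope ring_scope.

(** * Bombieri-Weyl products *)

(** Three obstacles shape the proof. At a logarithmic pair with [B(u, v) = 0] the denominator of
    Gamma vanishes and Gamma need not be continuous, so compactness of the spheres does not by
    itself give a maximum. When the arrangement is not free, a positive value of Gamma is available
    because every monomial of degree [n] is some [B(u, v)]; the positive exponent [1 - beta] then
    makes Gamma smaller than that value wherever R is small. The unit representatives are chosen
    without control of their phases, which may jump from one arrangement to the next. Continuity in
    the arrangement is therefore proved for another, locally continuous choice, and transported by
    invariance of Gamma under phases. Freeness only asks for some basis of degrees [1, d1, d2]: its
    element of degree one need not be the Euler field. Recovering a pair with nonzero Saito
    determinant takes a possible exchange of basis elements and a look at linear terms. *)

Section Multinomial.
Implicit Types m : multinom 3.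

(** The truncated division in [multinomial] is exact: adding one exponent at a time, each new
    quotient is a binomial coefficient. *)
Lemma multinomial_fact m :
  (multinomial m * \prod_(i < 3) (m i)`!)%N = (mdeg m)`!.
Proof.
apply: divnK; rewrite mdegE; elim/big_rec2: _ => // i x y _ xy.
have le_iy : (m i <= m i + y)%N by rewrite leq_addr.
by rewrite -(bin_fact le_iy) addKn; apply/dvdn_mull/dvdn_mul.
Qed.

Lemma multinomial_gt0 m : (0 < multinomial m)%N.
Proof.
have := fact_gt0 (mdeg m); rewrite -multinomial_fact.
by rewrite muln_gt0 => /andP[].
Qed.

(** This ratio of neighbouring weights is what makes multiplication by a variable adjoint to a
    partial derivative. *)
Lemma multinomialD1 m (j : 'I_3) :
  (multinomial (mnm_add m (mnm1 j)) * (m j).+1 = (mdeg m).+1 * multinomial m)%N.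
Proof.
have Pgt0 : (0 < \prod_(i < 3) (m i)`!)%N by apply: prodn_gt0 => i; apply: fact_gt0.
apply/eqP; rewrite -(eqn_pmul2r Pgt0) -mulnA.
have -> : ((m j).+1 * \prod_(i < 3) (m i)`!
           = \prod_(i < 3) ((mnm_add m (mnm1 j)) i)`!)%N.
  rewrite (bigD1 j)//= [in RHS](bigD1 j)//= mnmDE mnm1E eqxx addn1 factS mulnA.
  congr muln; apply: eq_bigr => i ij.
  by rewrite mnmDE mnm1E eq_sym (negPf ij) addn0.
by rewrite multinomial_fact mdegD mdeg1 addn1 factS -multinomial_fact mulnA.
Qed.

Lemma multinom_pick m : (0 < mdeg m)%N ->
  exists j m', m = mnm_add (mnm1 j) m'.
Proof.
move=> m0; have [j mj] : exists j, m j != 0%N.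
  apply/existsP; apply: contraLR m0; rewrite negb_exists => /forallP m0.
  by rewrite mdegE big1// => j _; apply/eqP; have := m0 j; rewrite negbK.
by exists j, (mnm_sub m (mnm1 j)); rewrite addmC submK// lep1mP.
Qed.

End Multinomial.

Section BombieriWeylTheory.
Variable R : realType.
Local Notation C := R[i].
Local Notation S := (Spoly R).
Implicit Types (d : nat) (p q r : S).

Lemma homogeneous0 d : homogeneous d (0 : S).
Proof. exact: rpred0. Qed.

Lemma homogeneousD d p q :
  homogeneous d p -> homogeneous d q -> homogeneous d (p + q).
Proof. exact: rpredD. Qed.

Lemma homogeneousB d p q :
  homogeneous d p -> homogeneous d q -> homogeneous d (p - q).
Proof. exact: rpredB. Qed.

Lemma homogeneousZ d (c : C) p : homogeneous d p -> homogeneous d (c *: p).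
Proof. exact: rpredZ. Qed.

Lemma homogeneousM d e p q :
  homogeneous d p -> homogeneous e q -> homogeneous (d + e) (p * q).
Proof. exact: dhomogM. Qed.

Lemma homogeneous_sum d (I : Type) (r : seq I) (P : pred I) (F : I -> S) :
  (forall i, P i -> homogeneous d (F i)) ->
  homogeneous d (\sum_(i <- r | P i) F i).
Proof. exact: rpred_sum. Qed.

Lemma homogeneousX m : homogeneous (mdeg m) (mpolyX C m : S).
Proof. by rewrite /homogeneous dhomogX. Qed.

Lemma homogeneous_coef d p m : homogeneous d p -> mdeg m != d -> mcoeff m p = 0.
Proof. exact: dhomog_nemf_coeff. Qed.

Lemma homogeneousE d p : homogeneous d p ->
  p = \sum_(m : bmultinom 3 d.+1 | mdeg m == d) mcoeff m p *: mpolyX C m.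
Proof.
move=> hp; rewrite {1}(@mpolywE _ _ d.+1 p).
  rewrite (bigID (fun m : bmultinom 3 d.+1 => mdeg m == d))/=.
  rewrite [Z in _ + Z]big1 ?addr0// => m md.
  by rewrite (homogeneous_coef hp md) scale0r.
rewrite msizeE; apply/bigmax_leqP_seq => m /(dhomog_mf hp) md _.
by rewrite md.
Qed.

Lemma bw_dotDl d p q r : bw_dot d (p + q) r = bw_dot d p r + bw_dot d q r.
Proof.
by rewrite /bw_dot -big_split/=; apply: eq_bigr => m _; rewrite mcoeffD !mulrDl.
Qed.

Lemma bw_dotZl d (c : C) p r : bw_dot d (c *: p) r = c * bw_dot d p r.
Proof.
by rewrite /bw_dot big_distrr/=; apply: eq_bigr => m _; rewrite mcoeffZ !mulrA.
Qed.

Lemma bw_dot_conj d p q : (bw_dot d p q)^* = bw_dot d q p.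
Proof.
rewrite /bw_dot rmorph_sum/=; apply: eq_bigr => m _.
by rewrite !rmorphM/= fmorphV conjCK rmorph_nat [_^* * _]mulrC.
Qed.

Lemma bw_dotDr d p q r : bw_dot d r (p + q) = bw_dot d r p + bw_dot d r q.
Proof. by rewrite -bw_dot_conj bw_dotDl rmorphD/= !bw_dot_conj. Qed.

Lemma bw_dotZr d (c : C) p r : bw_dot d r (c *: p) = c^* * bw_dot d r p.
Proof. by rewrite -bw_dot_conj bw_dotZl rmorphM/= bw_dot_conj. Qed.

Lemma bw_dot0l d r : bw_dot d 0 r = 0.
Proof. by rewrite -[0 in LHS](scale0r 0) bw_dotZl mul0r. Qed.

Lemma bw_dotNl d p r : bw_dot d (- p) r = - bw_dot d p r.
Proof. by rewrite -scaleN1r bw_dotZl mulN1r. Qed.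

Lemma bw_dotNr d p r : bw_dot d r (- p) = - bw_dot d r p.
Proof. by rewrite -bw_dot_conj bw_dotNl rmorphN/= bw_dot_conj. Qed.

Lemma bw_dot_suml d (I : Type) (s : seq I) (P : pred I) (F : I -> S) r :
  bw_dot d (\sum_(i <- s | P i) F i) r = \sum_(i <- s | P i) bw_dot d (F i) r.
Proof.
by apply: (big_morph (fun p => bw_dot d p r)) => [p q|]; rewrite ?bw_dotDl ?bw_dot0l.
Qed.

Lemma bw_dot_term_ge0 p m : 0 <= mcoeff m p * (mcoeff m p)^* / (multinomial m)%:R.
Proof. by rewrite divr_ge0 ?ler0n// mul_conjC_ge0. Qed.

Lemma bw_dot_ge0 d p : 0 <= bw_dot d p p.
Proof. by apply: sumr_ge0 => m _; apply: bw_dot_term_ge0. Qed.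

Lemma bw_dotXl d m q : mdeg m = d ->
  bw_dot d (mpolyX C m) q = (mcoeff m q)^* / (multinomial m)%:R.
Proof.
move=> md; have lt_md : (mdeg m < d.+1)%N by rewrite md.
rewrite /bw_dot (bigD1 (BMultinom lt_md)) ?md//= big1 ?addr0.
  by rewrite mcoeffX eqxx mul1r.
move=> k /andP[_ km]; rewrite mcoeffX; case: eqP => [mk|]; last by rewrite !mul0r.
by case/eqP: km; apply: val_inj; rewrite /= mk.
Qed.

Lemma bw_dot_coef_le d p m : mdeg m = d ->
  mcoeff m p * (mcoeff m p)^* / (multinomial m)%:R <= bw_dot d p p.
Proof.
move=> md; have lt_md : (mdeg m < d.+1)%N by rewrite md.
rewrite /bw_dot (bigD1 (BMultinom lt_md)) ?md//= lerDl.
by apply: sumr_ge0 => k _; apply: bw_dot_term_ge0.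
Qed.

Lemma bw_dot_eq0 d p : homogeneous d p -> bw_dot d p p = 0 -> p = 0.
Proof.
move=> hp p0; apply/mpolyP => m; rewrite mcoeff0.
have [md|md] := eqVneq (mdeg m) d; last exact: homogeneous_coef hp md.
have := bw_dot_coef_le p md; rewrite p0 => le0.
have /eqP : mcoeff m p * (mcoeff m p)^* / (multinomial m)%:R = 0.
  by apply/eqP; rewrite eq_le le0 bw_dot_term_ge0.
rewrite mulf_eq0 invr_eq0 pnatr_eq0 eqn0Ngt multinomial_gt0 orbF.
by rewrite mul_conjC_eq0 => /eqP.
Qed.

Lemma Re_ge0 (z : C) : 0 <= z -> 0 <= complex.Re z.
Proof. by rewrite lecE => /andP[]. Qed.

Lemma ReK (z : C) : 0 <= z -> ((complex.Re z)%:C)%C = z.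
Proof. by move=> z0; rewrite RRe_real// ger0_real. Qed.

Lemma conj_realC (x : R) : ((x%:C)%C : C)^* = (x%:C)%C.
Proof. by rewrite conj_Creal//; apply/complex_realP; exists x. Qed.

Lemma bw_norm_sqr d p : bw_norm d p ^+ 2 = complex.Re (bw_dot d p p).
Proof. by rewrite sqr_sqrtr// Re_ge0// bw_dot_ge0. Qed.

Lemma bw_norm_sqrC d p : ((bw_norm d p ^+ 2)%:C)%C = bw_dot d p p.
Proof. by rewrite bw_norm_sqr ReK// bw_dot_ge0. Qed.

Lemma bw_norm_gt0 d p : homogeneous d p -> p != 0 -> 0 < bw_norm d p.
Proof.
move=> hp p0; rewrite lt_neqAle sqrtr_ge0 andbT eq_sym; apply: contra p0 => /eqP n0.
by apply/eqP/(bw_dot_eq0 hp); rewrite -bw_norm_sqrC n0 expr0n.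
Qed.

Lemma bw_normZ d (c : C) p : bw_norm d (c *: p) = complex.Re `|c| * bw_norm d p.
Proof.
apply/eqP; rewrite -(eqrXn2 (_ : 0 < 2)%N) ?mulr_ge0 ?sqrtr_ge0 ?Re_ge0//.
apply/eqP/complexI; rewrite exprMn bw_norm_sqrC bw_dotZl bw_dotZr mulrA -normCK.
rewrite -bw_norm_sqrC [RHS]rmorphM [in RHS]rmorphXn.
by congr (_ ^+ 2 * _); apply/esym/ReK.
Qed.

(* Cauchy-Schwarz, from [0 <= ||p - <p,q> q||^2]. *)
Lemma bw_dot_unit_le d p q : bw_dot d q q = 1 ->
  `|bw_dot d p q| ^+ 2 <= bw_dot d p p.
Proof.
move=> q1; set c := bw_dot d p q.
have := bw_dot_ge0 d (p - c *: q).
suff -> : bw_dot d (p - c *: q) (p - c *: q) = bw_dot d p p - `|c| ^+ 2.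
  by rewrite subr_ge0.
rewrite bw_dotDl !bw_dotDr !bw_dotNl !bw_dotNr !bw_dotZl !bw_dotZr q1.
by rewrite -[bw_dot d q p]bw_dot_conj -/c normCK; ring.
Qed.

End BombieriWeylTheory.

(** * Substitution off a linear form, and the multiples of that form *)

Section PerpendicularRestriction.
Variable R : realType.
Local Notation C := R[i].
Local Notation S := (Spoly R).
Local Notation "''X_' j" := (mpolyX C (mnm1 j))
  (at level 8, j at level 2, format "''X_' j").
Implicit Types (d : nat) (p q f : S) (a b : 'rV[C]_3).

Lemma linformD a b : linform (a + b) = linform a + linform b.
Proof. by rewrite -big_split; apply: eq_bigr => j _; rewrite mxE scalerDl. Qed.

Lemma linformZ (c : C) a : linform (c *: a) = c *: linform a.
Proof. by rewrite scaler_sumr; apply: eq_bigr => j _; rewrite mxE scalerA. Qed.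

Lemma linformB a b : linform (a - b) = linform a - linform b.
Proof. by rewrite linformD -scaleN1r linformZ scaleN1r. Qed.

Lemma mcoeff_linform a j : mcoeff (mnm1 j) (linform a) = a 0 j.
Proof.
rewrite /linform raddf_sum/= (bigD1 j)//= mcoeffZ mcoeffXU eqxx mulr1 big1 ?addr0//.
by move=> i ij; rewrite mcoeffZ mcoeffXU (negPf ij) mulr0.
Qed.

Lemma linform_inj : injective (@linform R).
Proof. by move=> a b ab; apply/rowP => j; rewrite -!mcoeff_linform ab. Qed.

Lemma linform0 : linform (0 : 'rV[C]_3) = 0.
Proof. by rewrite -(scale0r 0) linformZ scale0r. Qed.

Lemma linform_eq0 a : (linform a == 0) = (a == 0).
Proof. by rewrite -linform0 (inj_eq linform_inj). Qed.

Lemma homogeneousX1 j : homogeneous 1 ('X_j : S).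
Proof. by rewrite /homogeneous dhomogX; apply/eqP/mdeg1. Qed.

Lemma homogeneous_linform a : homogeneous 1 (linform a).
Proof. by apply: homogeneous_sum => j _; apply/homogeneousZ/homogeneousX1. Qed.

Lemma mderiv_linform a j : mderiv j (linform a) = mpolyC 3 (a 0 j).
Proof.
rewrite /linform raddf_sum/= (bigD1 j)//= mderivZ mderivX mnm1E eqxx scale1r.
rewrite big1 ?addr0 => [|i ij].
  have -> : mnm_sub (mnm1 j) (mnm1 j) = @mnm0 3.
    by apply/mnmP => k; rewrite mnmBE subnn mnm0E.
  by rewrite mpolyX0 -mul_mpolyC mulr1.
by rewrite mderivZ mderivX mnm1E (negPf ij) scale0r scaler0.
Qed.

Definition form_dot a b : C := \sum_(j < 3) a 0 j * (b 0 j)^*.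

Lemma bw_dot_linform a b : bw_dot 1 (linform a) (linform b) = form_dot a b.
Proof.
rewrite {1}/linform bw_dot_suml; apply: eq_bigr => j _.
rewrite bw_dotZl bw_dotXl ?mdeg1// mcoeff_linform.
have -> : multinomial (mnm1 j) = 1%N.
  rewrite /multinomial mdeg1 big1 ?divn1// => i _.
  by rewrite mnm1E; case: eqP.
by rewrite divr1.
Qed.

Lemma form_dotZl (c : C) a b : form_dot (c *: a) b = c * form_dot a b.
Proof. by rewrite -!bw_dot_linform linformZ bw_dotZl. Qed.

(* [p] composed with the orthogonal projection of C^3 along the conjugate of
   [a]; for a unit [a], this is the orthogonal projection of S_d off
   [linform a * S_{d-1}]. *)
Definition perp a p : S :=
  comp_mpoly [tuple 'X_j - (a 0 j)^* *: linform a | j < 3] p.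

Lemma perpD a : {morph perp a : p q / p + q}.
Proof. exact: comp_mpolyD. Qed.

Lemma perpB a : {morph perp a : p q / p - q}.
Proof. exact: comp_mpolyB. Qed.

Lemma perpZ a c p : perp a (c *: p) = c *: perp a p.
Proof. exact: comp_mpolyZ. Qed.

Lemma perp0 a : perp a 0 = 0.
Proof. exact: comp_mpoly0. Qed.

Lemma perpM a : {morph perp a : p q / p * q}.
Proof. exact: rmorphM. Qed.

Lemma perp_sum a (I : Type) (r : seq I) (P : pred I) (F : I -> S) :
  perp a (\sum_(i <- r | P i) F i) = \sum_(i <- r | P i) perp a (F i).
Proof. exact: raddf_sum. Qed.

Lemma perp_prod a (I : Type) (r : seq I) (P : pred I) (F : I -> S) :
  perp a (\prod_(i <- r | P i) F i) = \prod_(i <- r | P i) perp a (F i).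
Proof. exact: rmorph_prod. Qed.

Lemma perpX1 a j : perp a 'X_j = 'X_j - (a 0 j)^* *: linform a.
Proof. by rewrite /perp comp_mpolyXU -tnth_nth tnth_mktuple. Qed.

Lemma perpX a m :
  perp a (mpolyX C m) = \prod_(j < 3) ('X_j - (a 0 j)^* *: linform a) ^+ m j.
Proof. by rewrite /perp comp_mpolyX; apply: eq_bigr => j _; rewrite tnth_mktuple. Qed.

Lemma perp_linform a b : perp a (linform b) = linform (b - form_dot b a *: a).
Proof.
rewrite perp_sum linformB linformZ [in RHS]/linform /form_dot scaler_suml -sumrB.
apply: eq_bigr => j _.
by rewrite perpZ perpX1 scalerBr scalerA.
Qed.

Lemma perp_self a : form_dot a a = 1 -> perp a (linform a) = 0.
Proof. by move=> a1; rewrite perp_linform a1 scale1r subrr linform0. Qed.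

Lemma homogeneous_perp a d p : homogeneous d p -> homogeneous d (perp a p).
Proof.
move=> hp; rewrite (homogeneousE hp) perp_sum; apply: homogeneous_sum => m.
move: (val m) => {hp}m /eqP <-; rewrite perpZ perpX; apply: homogeneousZ.
rewrite mdegE; elim/big_rec2: _ => [|j e q _ he]; first exact: dhomog1.
apply: homogeneousM => //.
rewrite -[Z in homogeneous Z]mul1n /homogeneous; apply: dhomogMn.
rewrite -/(homogeneous _ _).
apply: homogeneousB; first exact: homogeneousX1.
by apply/homogeneousZ/homogeneous_linform.
Qed.

Lemma multiples_homogeneous a d p :
  multiples (linform a) d p -> homogeneous d p.
Proof.
case: d => [->|d [q hq <-]]; first exact: homogeneous0.
by rewrite -add1n; apply: homogeneousM => //; exact: homogeneous_linform.
Qed.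

Lemma multiplesB f d p q :
  multiples f d p -> multiples f d q -> multiples f d (p - q).
Proof.
case: d => [-> ->|d [p' hp <-] [q' hq <-]]; first by rewrite /= subrr.
by exists (p' - q'); [exact: homogeneousB | rewrite mulrBr].
Qed.

Lemma multiplesZ f d c p : multiples f d p -> multiples f d (c *: p).
Proof.
case: d => [->|d [q hq <-]]; first by rewrite /= scaler0.
by exists (c *: q); [exact: homogeneousZ | rewrite scalerAr].
Qed.

Lemma multiples0 f d : multiples f d 0.
Proof. by case: d => //= d; exists 0; [exact: homogeneous0 | rewrite mulr0]. Qed.

Lemma multiplesD f d p q :
  multiples f d p -> multiples f d q -> multiples f d (p + q).
Proof.
move=> fp fq; rewrite -[q]opprK -[- q]scaleN1r.
by apply: multiplesB => //; apply: multiplesZ.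
Qed.

(** Modulo [linform a] each variable is congruent to its image under [perp a]. For monomials this
    propagates by peeling off one variable at a time. *)
Lemma perp_sub_multiples a d p :
  homogeneous d p -> multiples (linform a) d (p - perp a p).
Proof.
move=> hp; rewrite (homogeneousE hp) perp_sum -sumrB.
apply: big_ind; [exact: multiples0 | by move=> ? ?; exact: multiplesD | move=> m ].
rewrite perpZ -scalerBr => /eqP; move: (val m) => {hp}m md; apply: multiplesZ.
elim: d m md => [|d IHd] m md.
  move/eqP: md; rewrite mdeg_eq0 => /eqP ->.
  by rewrite perpX big1 ?mpolyX0 ?subrr// => j _; rewrite mnm0E expr0.
have [|j [m' mE]] := @multinom_pick m; first by rewrite md.
have md' : mdeg m' = d by move: md; rewrite mE mdegD mdeg1 add1n => -[].
have hX : homogeneous d (perp a (mpolyX C m')).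
  by apply: homogeneous_perp; rewrite -md'; exact: homogeneousX.
have -> : mpolyX C m - perp a (mpolyX C m) =
    'X_j * (mpolyX C m' - perp a (mpolyX C m'))
    + linform a * ((a 0 j)^* *: perp a (mpolyX C m')).
  rewrite mE mpolyXD perpM perpX1 mulrBl mulrBr -scalerAl -scalerAr.
  by rewrite opprD opprK addrA.
apply: multiplesD; last first.
  by exists ((a 0 j)^* *: perp a (mpolyX C m')); [exact: homogeneousZ|].
case: d IHd {md hX} md' => [|d] IHd md'.
  by rewrite (IHd _ md') mulr0; exact: multiples0.
have [q hq <-] := IHd _ md'.
exists ('X_j * q); last by rewrite mulrCA.
by apply: (@homogeneousM _ 1) => //; exact: homogeneousX1.
Qed.

(** The operator [D] is a derivation, and it kills every substituted variable since
    [(a 0 j)^* - (a 0 j)^* * form_dot a a = 0]. It therefore kills the algebra they generate, which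
    is the image of [perp a]. *)
Lemma mderiv_perp_eq0 a p : form_dot a a = 1 ->
  \sum_(j < 3) (a 0 j)^* *: mderiv j (perp a p) = 0.
Proof.
move=> a1; pose D p := \sum_(j < 3) (a 0 j)^* *: mderiv j p.
have DM q r : D (q * r) = D q * r + q * D r.
  rewrite /D big_distrl big_distrr -big_split/=; apply: eq_bigr => j _.
  by rewrite mderivM scalerDr scalerAl scalerAr.
have DX j : D ('X_j - (a 0 j)^* *: linform a) = 0.
  have -> : 'X_j = linform (delta_mx 0 j).
    rewrite /linform (bigD1 j)//= mxE !eqxx scale1r big1 ?addr0// => i ij.
    by rewrite mxE (negPf ij) andbF scale0r.
  rewrite -linformZ -linformB.
  transitivity (mpolyC 3 (\sum_(i < 3) (a 0 i)^* *
      (delta_mx 0 j - (a 0 j)^* *: a : 'rV[C]_3) 0 i)).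
    rewrite raddf_sum; apply: eq_bigr => i _.
    by rewrite mderiv_linform -mul_mpolyC -mpolyCM.
  rewrite -[RHS](mpolyC0 3 C); congr (mpolyC 3 _).
  transitivity ((a 0 j)^* - (a 0 j)^* * form_dot a a).
    rewrite /form_dot mulr_sumr -sumrN.
    rewrite [in LHS](eq_bigr (fun i => (a 0 i)^* * (i == j)%:R
       + - ((a 0 j)^* * (a 0 i * (a 0 i)^*)))).
      rewrite big_split/=; congr (_ + _).
      rewrite (bigD1 j)//= eqxx mulr1 big1 ?addr0// => i /negPf ->.
      by rewrite mulr0.
    by move=> i _; rewrite !mxE eqxx/=; ring.
  by rewrite a1 mulr1 subrr.
have D1 : D 1 = 0.
  by rewrite /D big1// => j _; rewrite -mpolyC1 mderivC scaler0.
have DXn q n : D q = 0 -> D (q ^+ n) = 0.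
  move=> Dq; elim: n => [|n IHn]; first by rewrite expr0 D1.
  by rewrite exprS DM Dq IHn mul0r mulr0 addr0.
rewrite -/(D _) [p]mpolyE perp_sum.
have -> (s : seq (multinom 3)) F : D (\sum_(m <- s) F m) = \sum_(m <- s) D (F m).
  rewrite /D exchange_big/=; apply: eq_bigr => j _.
  by rewrite (raddf_sum (mderiv j)) scaler_sumr.
rewrite big1// => m _.
have DZ (c : C) q : D (c *: q) = c *: D q.
  rewrite /D scaler_sumr; apply: eq_bigr => j _.
  by rewrite mderivZ !scalerA mulrC.
rewrite perpZ perpX DZ.
suff -> : D (\prod_(j < 3) ('X_j - (a 0 j)^* *: linform a) ^+ m j) = 0 by rewrite scaler0.
apply: (big_ind (fun q => D q = 0)) => [|q r Dq Dr|j _]; [exact: D1| |].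
  by rewrite DM Dq Dr mul0r mulr0 addr0.
by apply: DXn; apply: DX.
Qed.

End PerpendicularRestriction.

(** * Residuals in terms of the substitution [perp] *)

Section ResidualFormula.
Variable R : realType.
Local Notation C := R[i].
Local Notation S := (Spoly R).
Implicit Types (d : nat) (p q f : S) (a b : 'rV[C]_3) (u v : deriv3 R).

(* Multiplication by [linform a] and differentiation along the conjugate of [a]
   are adjoint up to the factor [d + 1]. *)
Lemma bw_dot_mul_linform a d p q : homogeneous d p ->
  bw_dot d.+1 (linform a * p) q =
  d.+1%:R^-1 * bw_dot d p (\sum_(j < 3) (a 0 j)^* *: mderiv j q).
Proof.
move=> hp; rewrite (homogeneousE hp) mulr_sumr !bw_dot_suml mulr_sumr.
apply: eq_bigr => m /eqP; move: (val m) => {hp}m md.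
rewrite -scalerAr !bw_dotZl mulrCA; congr (_ * _).
rewrite (bw_dotXl _ md) /linform mulr_suml bw_dot_suml.
rewrite raddf_sum/= rmorph_sum/= mulr_suml mulr_sumr; apply: eq_bigr => j _.
rewrite -scalerAl bw_dotZl -mpolyXD addmC bw_dotXl; last first.
  by rewrite mdegD mdeg1 md addn1.
rewrite mcoeffZ mcoeff_deriv rmorphM/= conjCK rmorphMn/=.
have := congr1 (fun n => n%:R : C) (multinomialD1 m j); rewrite /= !natrM md => E.
have M0 : (multinomial m)%:R != 0 :> C by rewrite pnatr_eq0 -lt0n multinomial_gt0.
have M1 : (multinomial (mnm_add m (mnm1 j)))%:R != 0 :> C.
  by rewrite pnatr_eq0 -lt0n multinomial_gt0.
have d0 : d.+1%:R != 0 :> C by rewrite pnatr_eq0.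
have m0 : (m j).+1%:R != 0 :> C by rewrite pnatr_eq0.
have -> : (multinomial (mnm_add m (mnm1 j)))%:R =
    d.+1%:R * (multinomial m)%:R / (m j).+1%:R :> C by rewrite -E mulfK.
rewrite -[X in _ = _ * (_ * X / _)]mulr_natr.
move: (_.+1%:R) m0 (_.+1%:R) d0 => x x0 y y0.
by field; rewrite x0 y0 M0.
Qed.

Lemma perp_orthogonal a d p w : form_dot a a = 1 -> homogeneous d p ->
  multiples (linform a) d w -> bw_dot d (perp a p) w = 0.
Proof.
move=> a1 hp; rewrite -bw_dot_conj; case: d hp => [|d] hp.
  by move=> ->; rewrite bw_dot0l conjC0.
move=> [q hq <-]; rewrite bw_dot_mul_linform// mderiv_perp_eq0//.
by rewrite -bw_dot_conj bw_dot0l conjC0 mulr0 conjC0.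
Qed.

Lemma orth_projE a d p : form_dot a a = 1 -> homogeneous d p ->
  orth_proj d (multiples (linform a) d) p = p - perp a p.
Proof.
move=> a1 hp; apply: xget_unique => /=.
  split; first exact: perp_sub_multiples.
  by move=> w Ww; rewrite subKr; exact: perp_orthogonal Ww.
(* Uniqueness of the projection: the difference of two candidates lies in the subspace and is
   orthogonal to it, so its norm is zero. *)
move=> w [Ww worth]; set w0 := p - perp a p.
have Wd : multiples (linform a) d (w - w0).
  by apply: multiplesB => //; exact: perp_sub_multiples.
apply/eqP; rewrite -subr_eq0; apply/eqP/(@bw_dot_eq0 _ d).
  exact: multiples_homogeneous Wd.
have -> : w - w0 = perp a p - (p - w) by rewrite /w0; ring.
rewrite {1}bw_dotDl bw_dotNl.
have -> : perp a p - (p - w) = w - w0 by rewrite /w0; ring.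
by rewrite (worth _ Wd) (perp_orthogonal a1 hp Wd) subrr.
Qed.

Definition contract a u : S := \sum_(j < 3) a 0 j *: u 0 j.

Lemma homogeneous_contract a d u : E_ d u -> homogeneous d (contract a u).
Proof. by move=> hu; apply: homogeneous_sum => j _; apply: homogeneousZ; apply: hu. Qed.

Lemma rhoE a d u : form_dot a a = 1 -> E_ d u ->
  rho a d u = perp a (contract a u).
Proof.
move=> a1 hu; rewrite /rho -/(contract a u) orth_projE ?subKr//.
exact: homogeneous_contract.
Qed.

(** No homogeneity here, because [log_derivations] contains inhomogeneous elements; the congruence
    modulo [linform a] is summed monomial by monomial. *)
Lemma perp_eq0P a p : form_dot a a = 1 ->
  perp a p = 0 <-> exists h, p = h * linform a.
Proof.
move=> a1; split=> [p0|[h ->]]; last by rewrite perpM perp_self// mulr0.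
suff [h ph] : exists h, p - perp a p = h * linform a.
  by exists h; rewrite -ph p0 subr0.
move: p {p0}; elim/mpolyind => [|c m p mp c0 [h IHp]].
  by exists 0; rewrite perp0 subrr mul0r.
have [h' hE] : exists h', mpolyX C m - perp a (mpolyX C m) = h' * linform a.
  have := perp_sub_multiples a (homogeneousX R m).
  case: (mdeg m) => [/= ->|d [q _ <-]]; first by exists 0; rewrite mul0r.
  by exists q; rewrite mulrC.
exists (c *: h' + h); rewrite perpD perpZ mulrDl -scalerAl -hE -IHp scalerBr.
by rewrite opprD addrACA.
Qed.

Lemma derivation_linform a u : derivation u (linform a) = contract a u.
Proof.
by apply: eq_bigr => j _; rewrite mderiv_linform mulrC mul_mpolyC.
Qed.

Lemma log_derivationsP n (a : 'I_n -> 'rV[C]_3) u :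
  (forall i, form_dot (a i) (a i) = 1) ->
  log_derivations a u <-> forall i, perp (a i) (contract (a i) u) = 0.
Proof.
move=> a1; rewrite /log_derivations/=; split=> H i.
  by apply/(perp_eq0P _ (a1 i)); rewrite -derivation_linform; exact: H.
by rewrite derivation_linform; apply/(perp_eq0P _ (a1 i)); exact: H.
Qed.

Lemma bw_normv_sqr d k (u : 'rV[S]_k) :
  bw_normv d u ^+ 2 = \sum_(j < k) bw_norm d (u 0 j) ^+ 2.
Proof.
have dE : bw_dotv d u u = ((\sum_(j < k) bw_norm d (u 0 j) ^+ 2)%:C)%C.
  by rewrite raddf_sum; apply: eq_bigr => j _; rewrite -bw_norm_sqrC.
rewrite /bw_normv dE /= sqr_sqrtr//.
by apply: sumr_ge0 => j _; exact: sqr_ge0.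
Qed.

Definition res_sqr n (a : 'I_n -> 'rV[C]_3) d u : R :=
  n%:R^-1 * \sum_(i < n) bw_norm d (perp (a i) (contract (a i) u)) ^+ 2.

Lemma Re_norm_real (x : R) : complex.Re `|(x%:C)%C : C| = `|x|.
Proof. by rewrite normc_def/= expr0n addr0 sqrtr_sqr. Qed.

Lemma residual_sqr n (a : 'I_n -> 'rV[C]_3) d u :
  (forall i, form_dot (a i) (a i) = 1) -> E_ d u ->
  bw_normv d (residual a d u) ^+ 2 = res_sqr a d u.
Proof.
move=> a1 hu; rewrite bw_normv_sqr /res_sqr mulr_sumr; apply: eq_bigr => i _.
rewrite mxE bw_normZ exprMn rhoE// Re_norm_real; congr (_ * _).
by rewrite real_normK ?num_real// exprVn sqr_sqrtr.
Qed.

Lemma res_sqr_ge0 n (a : 'I_n -> 'rV[C]_3) d u : 0 <= res_sqr a d u.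
Proof.
by rewrite mulr_ge0// ?invr_ge0// sumr_ge0// => i _; exact: sqr_ge0.
Qed.

Lemma res_sqr_eq0 n (a : 'I_n -> 'rV[C]_3) d u : (0 < n)%N ->
  (forall i, form_dot (a i) (a i) = 1) -> E_ d u ->
  res_sqr a d u = 0 <-> log_derivations a u.
Proof.
move=> n0 a1 hu; rewrite log_derivationsP//; split=> [/eqP|H]; last first.
  rewrite /res_sqr big1 ?mulr0// => i _.
  by rewrite H bw_norm_sqr bw_dot0l.
rewrite mulf_eq0 invr_eq0 pnatr_eq0 eqn0Ngt n0/= => /eqP/psumr_eq0P H i.
apply/(@bw_dot_eq0 _ d); first exact/homogeneous_perp/homogeneous_contract.
by rewrite -bw_norm_sqrC H// => j _; exact: sqr_ge0.
Qed.

Lemma R_E n (a : 'I_n -> 'rV[C]_3) d1 d2 u v :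
  (forall i, form_dot (a i) (a i) = 1) -> E_ d1 u -> E_ d2 v ->
  R_ a d1 d2 u v = res_sqr a d1 u + res_sqr a d2 v.
Proof. by move=> a1 hu hv; rewrite /R_ !residual_sqr. Qed.

End ResidualFormula.

(** * Saito's criterion *)

Section SaitoCriterion.
Variable R : realType.
Local Notation C := R[i].
Local Notation S := (Spoly R).
Local Notation "''X_' j" := (mpolyX C (mnm1 j))
  (at level 8, j at level 2, format "''X_' j").
Implicit Types (d : nat) (p q f : S) (u v : deriv3 R).

Section Forms.
Variables (n : nat) (a : 'I_n -> 'rV[C]_3).
Hypothesis a1 : forall i, form_dot (a i) (a i) = 1.
Hypothesis aI : forall i j (c : C), a i = c *: a j -> i = j.

Lemma unit_form_neq0 i : a i != 0.
Proof.
apply: contraTneq (oner_neq0 C) => ai0; rewrite -(a1 i) ai0 negbK.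
by apply/eqP/big1 => j _; rewrite mxE mul0r.
Qed.

Lemma linform_unit_neq0 i : linform (a i) != 0.
Proof. by rewrite linform_eq0 unit_form_neq0. Qed.

Lemma defining_poly_neq0 : defining_poly a != 0.
Proof. by apply/prodf_neq0 => i _; exact: linform_unit_neq0. Qed.

Lemma homogeneous_defining_poly : homogeneous n (defining_poly a).
Proof.
rewrite -[X in homogeneous X](card_ord n) -sum1_card /defining_poly.
elim/big_rec2: _ => [|i d q _ hq]; first exact: dhomog1.
by apply: homogeneousM => //; exact: homogeneous_linform.
Qed.

Lemma perp_linform_neq0 i j : i != j -> perp (a i) (linform (a j)) != 0.
Proof.
rewrite perp_linform linform_eq0 subr_eq0; apply: contra => /eqP E.
by apply/eqP/esym; apply: aI E.
Qed.

(** Each [perp (a i)] is a ring morphism into a domain, with kernel generated by [linform (a i)],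
    and it kills no other form of the family. So the forms can be divided out one after another. *)
Lemma defining_poly_dvd f :
  (forall i, perp (a i) f = 0) -> exists h, f = h * defining_poly a.
Proof.
move=> fa; rewrite /defining_poly.
suff: forall s : seq 'I_n, uniq s ->
    exists h, f = h * \prod_(i <- s) linform (a i).
  by apply; exact: index_enum_uniq.
elim=> [_|i s IHs /= /andP[iNs us]]; first by exists f; rewrite big_nil mulr1.
have [h hE] := IHs us.
have /perp_eq0P[//|k kE] : perp (a i) h = 0.
  have := fa i; rewrite hE perpM => /eqP; rewrite mulf_eq0 => /orP[/eqP//|].
  rewrite perp_prod prodf_seq_eq0 => /hasP[j js] /=.
  rewrite (negPf (perp_linform_neq0 _))//.
  by apply: contraNneq iNs => ->.
by exists k; rewrite hE kE big_cons mulrA.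
Qed.

Lemma perp_defining_poly i : perp (a i) (defining_poly a) = 0.
Proof.
by rewrite perp_prod (bigD1 i)//= perp_self// mul0r.
Qed.

(** After applying [perp (a i)] entrywise, the matrix annihilates the nonzero constant vector of
    coefficients of [a i]. Multiplying by the adjugate shows that its determinant vanishes. *)
Lemma log_derivations_det_dvd (M : 'M[S]_3) :
  (forall k, log_derivations a (row k M)) ->
  exists h, \det M = h * defining_poly a.
Proof.
move=> DM; apply: defining_poly_dvd => i.
have [j aij] : exists j, a i 0 j != 0.
  by have /rV0Pn := unit_form_neq0 i.
rewrite /perp -det_map_mx.
set N := map_mx _ M; pose w : 'cV[S]_3 := \col_j mpolyC 3 (a i 0 j).
have Nw : N *m w = 0.
  apply/colP => k; have /(log_derivationsP _ a1)/(_ i) := DM k.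
  rewrite perp_sum => E; rewrite !mxE -[RHS]E; apply: eq_bigr => l _.
  by rewrite !mxE perpZ mulrC mul_mpolyC.
have : (\det N)%:M *m w = 0 by rewrite -mul_adj_mx -mulmxA Nw mulmx0.
move=> /matrixP/(_ j 0); rewrite mul_scalar_mx !mxE => /eqP.
by rewrite mulf_eq0 mpolyC_eq0 (negPf aij) orbF => /eqP.
Qed.

End Forms.

Definition saito_mx u v : 'M[S]_3 :=
  \matrix_(k < 3, j < 3) nth 0 [:: 'X_j; u 0 j; v 0 j] k.

Lemma saito_mx_row0 u v : row 0 (saito_mx u v) = \row_j 'X_j.
Proof. by apply/rowP => j; rewrite !mxE. Qed.

Lemma saito_mx_row1 u v : row 1 (saito_mx u v) = u.
Proof. by apply/rowP => j; rewrite !mxE. Qed.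

Lemma saito_mx_row2 u v : row 2%:R (saito_mx u v) = v.
Proof. by apply/rowP => j; rewrite !mxE. Qed.

Lemma ord3P (P : 'I_3 -> Prop) : P 0 -> P 1 -> P 2%:R -> forall k, P k.
Proof.
move=> P0 P1 P2 [[|[|[|k]]] k3] //.
- by rewrite (_ : Ordinal k3 = 0)//; exact: val_inj.
- by rewrite (_ : Ordinal k3 = 1)//; exact: val_inj.
- by rewrite (_ : Ordinal k3 = 2%:R)//; exact: val_inj.
Qed.

Lemma homogeneous_det (deg : 'I_3 -> nat) (M : 'M[S]_3) :
  (forall k j, homogeneous (deg k) (M k j)) ->
  homogeneous (\sum_k deg k) (\det M).
Proof.
move=> hM; apply: homogeneous_sum => s _; rewrite /homogeneous rpredMsign.
elim/big_rec2: _ => [|i d q _ hq]; first exact: dhomog1.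
exact: homogeneousM.
Qed.

Lemma homogeneous_saito_det d1 d2 u v : E_ d1 u -> E_ d2 v ->
  homogeneous (d1 + d2 + 1) (saito_det u v).
Proof.
move=> hu hv; pose deg (k : 'I_3) := nth 0%N [:: 1%N; d1; d2] k.
have -> : (d1 + d2 + 1 = \sum_k deg k)%N.
  by rewrite !big_ord_recl big_ord0 addn0 /= addnC.
apply: homogeneous_det; elim/ord3P => j; rewrite !mxE/=.
- exact: homogeneousX1.
- exact: hu.
- exact: hv.
Qed.

Lemma homogeneous_msize d p : homogeneous d p -> p != 0 -> msize p = d.+1.
Proof.
by move=> hp p0; rewrite -mlead_deg// (dhomog_mf hp)// mlead_supp.
Qed.

Section FreenessCriterion.
Variables (n d1 d2 : nat) (a : 'I_n -> 'rV[C]_3).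
Hypothesis nE : (d1 + d2 + 1)%N = n.
Hypothesis a1 : forall i, form_dot (a i) (a i) = 1.
Hypothesis aI : forall i j (c : C), a i = c *: a j -> i = j.
Local Notation Q := (defining_poly a).

Lemma log_derivations_euler : log_derivations a (\row_j 'X_j).
Proof.
apply/log_derivationsP => // i; rewrite -[RHS](perp_self (a1 i)); congr perp.
by apply: eq_bigr => j _; rewrite mxE.
Qed.

Lemma log_derivations_saito_mx u v :
  log_derivations a u -> log_derivations a v ->
  forall k, log_derivations a (row k (saito_mx u v)).
Proof.
move=> Du Dv; elim/ord3P.
- by rewrite saito_mx_row0; exact: log_derivations_euler.
- by rewrite saito_mx_row1.
- by rewrite saito_mx_row2.
Qed.

(** The determinant is a multiple of [Q], and both are homogeneous of degree [n], so a nonzero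
    cofactor has [msize] 1, that is, it is constant. *)
Lemma saito_det_log u v : E_ d1 u -> E_ d2 v ->
  log_derivations a u -> log_derivations a v ->
  exists c : C, saito_det u v = c *: Q.
Proof.
move=> hu hv Du Dv.
have [h hE] : exists h, saito_det u v = h * Q.
  by apply: log_derivations_det_dvd => //; exact: log_derivations_saito_mx.
have [h0|h0] := eqVneq h 0; first by exists 0; rewrite hE h0 mul0r scale0r.
have Q0 := defining_poly_neq0 a1.
have := homogeneous_saito_det hu hv; rewrite nE hE => /homogeneous_msize.
rewrite mulf_neq0// => /(_ isT); rewrite msizeM//.
rewrite (homogeneous_msize (homogeneous_defining_poly a) Q0) addnS/= => hs.
exists (mcoeff (@mnm0 3) h); rewrite -mul_mpolyC -msize1_polyC//.
by rewrite -(leq_add2r n) hs add1n.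
Qed.

(** The body of [free_with_exponents] for an arbitrary family of forms; at [unit_forms A] the two
    are convertible. *)
Definition free_forms := 
  exists theta : 'I_3 -> deriv3 R,
    [/\ forall k, log_derivations a (theta k),
        forall k : 'I_3, E_ (nth 0%N [:: 1; d1; d2]%N k) (theta k)
      & forall eta, log_derivations a eta ->
          exists! c : 'rV[S]_3, eta = \sum_(k < 3) c 0 k *: theta k].

(** The basis is the Euler field, [u] and [v]. Cramer's rule gives the coordinates of a logarithmic
    [eta] as fractions over [\det M = c *: Q], and logarithmicity makes every numerator divisible by
    [Q]. *)
Lemma saito_det_neq0_free u v : E_ d1 u -> E_ d2 v ->
  log_derivations a u -> log_derivations a v -> saito_det u v != 0 ->
  free_forms.
Proof.
move=> hu hv Du Dv B0; have [c cE] := saito_det_log hu hv Du Dv.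
have c0 : c != 0 by apply: contraNneq B0 => c0; rewrite cE c0 scale0r.
set M := saito_mx u v.
have DM : forall k, log_derivations a (row k M) by exact: log_derivations_saito_mx.
exists (fun k => row k M); split => //.
  elim/ord3P => /=; rewrite ?saito_mx_row0 ?saito_mx_row1 ?saito_mx_row2//.
  by move=> j; rewrite mxE; exact: homogeneousX1.
move=> eta Deta.
have detM : \det M != 0 by [].
have {}cE : \det M = c *: Q by [].
move: M DM detM cE => M DM detM cE.
have Munique (x y : 'rV[S]_3) : x *m M = y *m M -> x = y.
  move=> xy; have : (x - y) *m (\det M)%:M = 0.
    by rewrite -mul_mx_adj mulmxA mulmxBl xy subrr mul0mx.
  move=> /rowP xy0; apply/rowP => k; have := xy0 k.
  rewrite mul_mx_scalar !mxE => /eqP; rewrite mulf_eq0 (negPf detM)/= subr_eq0.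
  by move/eqP.
(* The numerators of Cramer's rule: row [k] is replaced by [eta], so all rows remain logarithmic. *)
pose Mk k := \matrix_(i, j) (if i == k then eta 0 j else M i j).
have /choice[h hE] : forall k, exists h, \det (Mk k) = h * Q.
  move=> k; apply: log_derivations_det_dvd => // i.
  have [->|ik] := eqVneq i k.
    by rewrite (_ : row _ _ = eta)//; apply/rowP => j; rewrite !mxE eqxx.
  rewrite (_ : row _ _ = row i M)//; apply/rowP => j.
  by rewrite !mxE (negPf ik).
have adjE k : (eta *m \adj M) 0 k = h k * Q.
  rewrite -hE (expand_det_row _ k) mxE; apply: eq_bigr => j _.
  rewrite [\adj _ _ _]mxE [Mk _ _ _]mxE eqxx; congr (_ * (_ * \det _)).
  by apply/matrixP => i l; rewrite !mxE eq_sym (negPf (neq_lift _ _)).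
have etaE : eta = (\row_k (c^-1 *: h k)) *m M.
  have : (eta *m \adj M) *m M = (\row_k (h k * Q)) *m M.
    by congr (_ *m M); apply/rowP => k; rewrite adjE mxE.
  rewrite -mulmxA mul_adj_mx mul_mx_scalar => E.
  have Ej j : \det M * eta 0 j = \sum_k h k * Q * M k j.
    have := congr1 (fun x : 'rV[S]_3 => x 0 j) E.
    rewrite [LHS]mxE => ->; rewrite [LHS]mxE; apply: eq_bigr => k _.
    by rewrite [X in X * _]mxE.
  apply/rowP => j; apply: (mulfI detM); rewrite {}Ej [in RHS]mxE mulr_sumr.
  apply: eq_bigr => k _; rewrite [X in _ * (X * _)]mxE cE.
  rewrite -!scalerAl -scalerAr scalerA.
  by rewrite divff// scale1r mulrA [Q * _]mulrC.
exists (\row_k (c^-1 *: h k)); split; first by rewrite -mulmx_sum_row.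
by move=> y yE; apply: Munique; rewrite -etaE yE; exact/esym/mulmx_sum_row.
Qed.

End FreenessCriterion.
End SaitoCriterion.

(** * From a free basis to a pair with nonzero Saito determinant *)

Section FreenessCriterionConverse.
Variable R : realType.
Local Notation C := R[i].
Local Notation S := (Spoly R).
Implicit Types (d : nat) (p q f : S) (u v : deriv3 R).

Lemma det_mx33 (K : comPzRingType) (A : 'M[K]_3) :
  \det A = A 0 0 * (A 1 1 * A 2%:R 2%:R - A 1 2%:R * A 2%:R 1)
         - A 0 1 * (A 1 0 * A 2%:R 2%:R - A 1 2%:R * A 2%:R 0)
         + A 0 2%:R * (A 1 0 * A 2%:R 1 - A 1 1 * A 2%:R 0).
Proof.
have o1 : lift (0 : 'I_3) (0 : 'I_2) = 1 by exact: val_inj.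
have o2 : lift (0 : 'I_3) (1 : 'I_2) = 2%:R by exact: val_inj.
have o3 : lift (1 : 'I_3) (0 : 'I_2) = 0 by exact: val_inj.
have o4 : lift (1 : 'I_3) (1 : 'I_2) = 2%:R by exact: val_inj.
have o5 : lift (2%:R : 'I_3) (0 : 'I_2) = 0 by exact: val_inj.
have o6 : lift (2%:R : 'I_3) (1 : 'I_2) = 1 by exact: val_inj.
have det2 (B : 'M[K]_2) : \det B = B 0 0 * B 1 1 - B 0 1 * B 1 0.
  rewrite (expand_det_row _ 0) !big_ord_recl big_ord0 addr0 /cofactor !det_mx11 !mxE.
  have p1 : lift (ord0 : 'I_2) (ord0 : 'I_1) = 1 by exact: val_inj.
  have p2 : lift (0 : 'I_2) (0 : 'I_1) = 1 by exact: val_inj.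
  have p3 : lift (1 : 'I_2) (0 : 'I_1) = 0 by exact: val_inj.
  by rewrite !(p1, p2, p3)/= !addn0 add0n expr0 expr1; ring.
have s3 (F : 'I_3 -> K) : \sum_k F k = F 0 + F 1 + F 2%:R.
  rewrite !big_ord_recl big_ord0 addr0 addrA.
  by congr (_ + F _ + F _); exact: val_inj.
rewrite (expand_det_row _ 0) s3 /cofactor !det2 !mxE !(o1, o2, o3, o4, o5, o6).
by rewrite /= !add0n expr0 expr1 sqrrN expr1n; ring.
Qed.

(** Rows: [c] and the unit vectors of index [i] and [j]. If [c] holds the coordinates of the Euler
    field in a basis, this matrix times the basis matrix has rows Euler, [theta i], [theta j]. *)
Definition frame_mx (K : pzRingType) (c : 'rV[K]_3) (i j : 'I_3) : 'M[K]_3 :=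
  \matrix_(l < 3, m < 3) nth 0 [:: c 0 m; (i == m)%:R; (j == m)%:R] l.

Lemma det_frame_mx12 (K : comPzRingType) (c : 'rV[K]_3) :
  \det (frame_mx c 1 2%:R) = c 0 0.
Proof. by rewrite det_mx33 !mxE/=; ring. Qed.

Lemma det_frame_mx02 (K : comPzRingType) (c : 'rV[K]_3) :
  \det (frame_mx c 0 2%:R) = - c 0 1.
Proof. by rewrite det_mx33 !mxE/=; ring. Qed.

Lemma det_frame_mx10 (K : comPzRingType) (c : 'rV[K]_3) :
  \det (frame_mx c 1 0) = - c 0 2%:R.
Proof. by rewrite det_mx33 !mxE/=; ring. Qed.

Lemma mcoeff0M p q : mcoeff (@mnm0 3) (p * q) = mcoeff (@mnm0 3) p * mcoeff (@mnm0 3) q.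
Proof. exact: rmorphM. Qed.

Lemma mcoeff_mnm1 j p : mcoeff (mnm1 j) p = mcoeff (@mnm0 3) (mderiv j p).
Proof. by rewrite mcoeff_deriv mnm0E add0m. Qed.

Variables (n d1 d2 : nat) (a : 'I_n -> 'rV[C]_3).
Hypothesis a1 : forall i, form_dot (a i) (a i) = 1.
Local Notation Q := (defining_poly a).

Lemma free_saito_det_neq0 : free_forms d1 d2 a ->
  exists u v, [/\ E_ d1 u, E_ d2 v, log_derivations a u, log_derivations a v
    & saito_det u v != 0].
Proof.
move=> [theta [Dtheta htheta basis]].
pose M : 'M[S]_3 := \matrix_(k, j) theta k 0 j.
have rowM k : row k M = theta k by apply/rowP => j; rewrite !mxE.
have gen eta : log_derivations a eta -> exists c, eta = c *m M.
  move=> /basis[c [cE _]]; exists c; rewrite cE mulmx_sum_row.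
  by apply: eq_bigr => k _; rewrite rowM.
(* Each [Q *: delta_mx 0 j] is logarithmic, so the scalar matrix of [Q] factors through [M], and
   [Q ^+ 3] is a multiple of [\det M]. *)
have detM : \det M != 0.
  have /choice[P PE] : forall j : 'I_3,
      exists c : 'rV[S]_3, Q *: delta_mx 0 j = c *m M.
    move=> j; apply: gen; apply/log_derivationsP => // i.
    rewrite perp_sum big1// => l _.
    by rewrite perpZ !mxE perpM perp_defining_poly// mul0r scaler0.
  have : Q%:M = (\matrix_j P j) *m M.
    apply/row_matrixP => j; rewrite row_mul rowK -PE.
    by apply/rowP => l; rewrite !mxE eqxx/= eq_sym mulr_natr.
  move=> /(congr1 determinant); rewrite det_scalar det_mulmx => E.
  have : Q ^+ 3 != 0 by rewrite expf_neq0// defining_poly_neq0.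
  by rewrite E mulf_eq0 negb_or => /andP[].
have [c cE] := gen _ (log_derivations_euler a1).
have saitoE (i j : 'I_3) : saito_det (theta i) (theta j) =
    \det (frame_mx c i j) * \det M.
  rewrite -det_mulmx; congr (\det _).
  have mulM (w : 'rV[S]_3) m : (w *m M) 0 m = \sum_k w 0 k * theta k 0 m.
    by rewrite mxE; apply: eq_bigr => l _; rewrite mxE.
  apply/matrixP => l m; rewrite !mxE.
  elim/ord3P: l => /=.
  - move/rowP/(_ m): cE; rewrite mulM mxE => ->.
    by apply: eq_bigr => l _; rewrite !mxE.
  - rewrite (bigD1 i)//= !mxE eqxx mul1r big1 ?addr0// => l /negPf il.
    by rewrite !mxE/= eq_sym il mul0r.
  - rewrite (bigD1 j)//= !mxE eqxx mul1r big1 ?addr0// => l /negPf il.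
    by rewrite !mxE/= eq_sym il mul0r.
(* The Saito determinant of two basis elements is, up to sign, the Euler coordinate on the third one
   times [\det M]. If that coordinate is zero for [theta 0], then [theta 0] may replace another
   element of degree one. *)
have [c0|c0] := eqVneq (c 0 0) 0; last first.
  exists (theta 1), (theta 2%:R); split;
    [exact: (htheta 1)|exact: (htheta 2%:R)|exact: Dtheta|exact: Dtheta|].
  by rewrite saitoE mulf_eq0 negb_or det_frame_mx12 c0 detM.
have [/andP[/eqP d11 c1]|c1] := boolP ((d1 == 1%N) && (c 0 1 != 0)).
  exists (theta 0), (theta 2%:R); split;
    [by rewrite d11; exact: (htheta 0)|exact: (htheta 2%:R)|exact: Dtheta|exact: Dtheta|].
  by rewrite saitoE mulf_eq0 negb_or det_frame_mx02 oppr_eq0 c1 detM.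
have [/andP[/eqP d21 c2]|c2] := boolP ((d2 == 1%N) && (c 0 2%:R != 0)).
  exists (theta 1), (theta 0); split;
    [exact: (htheta 1)|by rewrite d21; exact: (htheta 0)|exact: Dtheta|exact: Dtheta|].
  by rewrite saitoE mulf_eq0 negb_or det_frame_mx10 oppr_eq0 c2 detM.
(* Otherwise the Jacobian matrix at 0 of the Euler field would have rank < 3. *)
pose G : 'M[C]_3 := \matrix_(i, k) mcoeff (mnm1 i) (c 0 k).
pose H : 'M[C]_3 := \matrix_(k, j) mcoeff (@mnm0 3) (theta k 0 j).
(* Linear terms of [theta k] occur only in degree one, and the excluded cases force [c 0 k = 0]
   there. Hence the linear part of the Euler field comes from the linear parts of [c] and the
   constant parts of [theta], and reads [1 = G *m H] with column 0 of [G] zero. *)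
have cth k i j : mcoeff (@mnm0 3) (c 0 k) * mcoeff (mnm1 i) (theta k 0 j) = 0.
  have [->|ck] := eqVneq (c 0 k) 0; first by rewrite mcoeff0 mul0r.
  rewrite (homogeneous_coef (htheta k j)) ?mulr0// mdeg1 eq_sym.
  move: k ck; elim/ord3P => /=.
  - by rewrite c0 eqxx.
  - by move=> c10; move: c1; rewrite c10 andbT.
  - by move=> c20; move: c2; rewrite c20 andbT.
have GH : G *m H = 1%:M.
  apply/matrixP => i j; move/rowP/(_ j): cE; rewrite !mxE.
  move=> /(congr1 (mcoeff (mnm1 i))); rewrite mcoeffXU eq_sym => ->.
  rewrite raddf_sum; apply: eq_bigr => k _; rewrite !mxE.
  rewrite /= [RHS]mcoeff_mnm1 mderivM mcoeffD !mcoeff0M -!mcoeff_mnm1.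
  by rewrite cth addr0.
have : \det G * \det H = 1 by rewrite -det_mulmx GH det1.
rewrite (expand_det_col _ 0) big1 ?mul0r => [/esym/eqP|i _].
  by rewrite oner_eq0.
by rewrite mxE c0 mcoeff0 mul0r.
Qed.

End FreenessCriterionConverse.

(** * Coefficientwise convergence *)

Section CoefficientwiseConvergence.
Variables (R : realType) (T : Type) (F : set_system T).
Hypothesis FF : Filter F.
Local Notation C := R[i].
Local Notation S := (Spoly R).
Local Notation "''X_' j" := (mpolyX C (mnm1 j))
  (at level 8, j at level 2, format "''X_' j").
Implicit Types (z : T -> C) (p : T -> S) (q : S) (u : T -> deriv3 R) (v : deriv3 R).

Lemma cvg_conj z (l : C) : (z : T -> C^o) @ F --> (l : C^o) ->
  (fun t => (z t)^* : C^o) @ F --> (l^* : C^o).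
Proof.
move=> /cvgrPdist_lt zl; apply/cvgrPdist_lt => e e0.
near=> t; rewrite -rmorphB norm_conjC; near: t; exact: zl.
Unshelve. all: by end_near. Qed.

Lemma ler_normRe (x : C) : `|complex.Re x| <= complex.Re `|x|.
Proof. by rewrite -lecR (ReK (normr_ge0 x)) normc_ge_Re. Qed.

Lemma cvg_Re z (l : C) : (z : T -> C^o) @ F --> (l : C^o) ->
  (fun t => complex.Re (z t)) @ F --> complex.Re l.
Proof.
move=> /cvgrPdist_lt zl; apply/cvgrPdist_lt => e e0.
have e0' : 0 < (e%:C)%C :> C by rewrite ltcR.
near=> t; have : `|l - z t| < (e%:C)%C by near: t; exact: zl.
rewrite ltcE => /andP[_]; apply: le_lt_trans.
by rewrite -raddfB; exact: ler_normRe.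
Unshelve. all: by end_near. Qed.

Lemma cvg_complex (x y : T -> R) (a b : R) : x @ F --> a -> y @ F --> b ->
  (fun t => (x t +i* y t)%C : C^o) @ F --> ((a +i* b)%C : C^o).
Proof.
move=> /cvgrPdist_lt xa /cvgrPdist_lt yb; apply/cvgrPdist_lt => e e0.
have e2 : 0 < complex.Re e / 2.
  by rewrite divr_gt0//; move: e0; rewrite ltcE => /andP[].
near=> t.
have -> : (a +i* b)%C - (x t +i* y t)%C
    = ((a - x t)%:C)%C + 'i%C * ((b - y t)%:C)%C.
  by simpc.
apply: le_lt_trans (ler_normD _ _) _.
have -> : `|'i%C * ((b - y t)%:C)%C| = `|(((b - y t)%:C)%C : C)|.
  rewrite normrM [X in X * _](_ : _ = 1) ?mul1r//.
  by rewrite normc_def/= expr0n expr1n add0r sqrtr1.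
rewrite !normc_def/= !expr0n/= !addr0 !sqrtr_sqr -rmorphD/=.
rewrite ltcE/=; apply/andP; split.
  by rewrite eq_sym; apply/eqP; have /ltW/ger0_Im := e0.
rewrite [X in _ < X]splitr; apply: ltrD.
  by near: t; exact: xa.
by near: t; exact: yb.
Unshelve. all: by end_near. Qed.

Lemma cvg_sumC (I : Type) (r : seq I) (P : pred I) (f : I -> T -> C^o) (l : I -> C^o) :
  (forall i, P i -> f i @ F --> l i) ->
  (fun t => \sum_(i <- r | P i) f i t : C^o) @ F --> (\sum_(i <- r | P i) l i : C^o).
Proof. by move=> fl; apply: cvg_big => //; exact: add_continuous. Qed.

(** Stated along an arbitrary filter, so that one set of lemmas serves both moving derivations and
    moving lines. *)
Definition cvg_poly p (q : S) :=
  forall m, (fun t => mcoeff m (p t) : C^o) @ F --> (mcoeff m q : C^o).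

Lemma cvg_poly_cst (q : S) : cvg_poly (fun=> q) q.
Proof. by move=> m; exact: cvg_cst. Qed.

Lemma cvg_polyD p1 p2 q1 q2 : cvg_poly p1 q1 -> cvg_poly p2 q2 ->
  cvg_poly (fun t => p1 t + p2 t) (q1 + q2).
Proof.
move=> h1 h2 m; rewrite mcoeffD.
under [X in X @ _]eq_fun do rewrite mcoeffD.
exact: (cvgD (h1 m) (h2 m)).
Qed.

Lemma cvg_polyZ z l p q : (z : T -> C^o) @ F --> (l : C^o) -> cvg_poly p q ->
  cvg_poly (fun t => z t *: p t) ((l : C) *: q).
Proof.
move=> hz hp m; rewrite mcoeffZ.
under [X in X @ _]eq_fun do rewrite mcoeffZ.
exact: (cvgM hz (hp m)).
Qed.

Lemma cvg_polyM p1 p2 q1 q2 : cvg_poly p1 q1 -> cvg_poly p2 q2 ->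
  cvg_poly (fun t => p1 t * p2 t) (q1 * q2).
Proof.
move=> h1 h2 m; rewrite mcoeffM.
under [X in X @ _]eq_fun do rewrite mcoeffM.
by apply: cvg_sumC => k _; exact: (cvgM (h1 _) (h2 _)).
Qed.

Lemma cvg_poly_sum (I : Type) (r : seq I) (P : pred I) (f : I -> T -> S) (l : I -> S) :
  (forall i, P i -> cvg_poly (f i) (l i)) ->
  cvg_poly (fun t => \sum_(i <- r | P i) f i t) (\sum_(i <- r | P i) l i).
Proof.
move=> fl m; rewrite raddf_sum.
under [X in X @ _]eq_fun do rewrite raddf_sum.
by apply: cvg_sumC => i Pi; exact: fl.
Qed.

Lemma cvg_poly_prod (I : Type) (r : seq I) (P : pred I) (f : I -> T -> S) (l : I -> S) :
  (forall i, P i -> cvg_poly (f i) (l i)) ->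
  cvg_poly (fun t => \prod_(i <- r | P i) f i t) (\prod_(i <- r | P i) l i).
Proof.
move=> fl; elim: r => [|i r IHr].
  rewrite big_nil; under [X in cvg_poly X]eq_fun do rewrite big_nil.
  exact: cvg_poly_cst.
rewrite big_cons; under [X in cvg_poly X]eq_fun do rewrite big_cons.
by case: ifPn => Pi; [exact: cvg_polyM (fl i Pi) IHr|exact: IHr].
Qed.

Lemma cvg_polyX p q k : cvg_poly p q -> cvg_poly (fun t => p t ^+ k) (q ^+ k).
Proof.
move=> pq; elim: k => [|k IHk]; first exact: cvg_poly_cst.
rewrite exprS; under [X in cvg_poly X]eq_fun do rewrite exprS.
exact: cvg_polyM pq IHk.
Qed.

Lemma cvg_bw_dot d p1 p2 q1 q2 : cvg_poly p1 q1 -> cvg_poly p2 q2 ->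
  (fun t => bw_dot d (p1 t) (p2 t) : C^o) @ F --> (bw_dot d q1 q2 : C^o).
Proof.
move=> h1 h2; apply: cvg_sumC => m _.
exact: (cvgM (cvgM (h1 _) (cvg_conj (h2 _))) (cvg_cst _)).
Qed.

Lemma cvg_bw_norm_sqr d p q : cvg_poly p q ->
  (fun t => bw_norm d (p t) ^+ 2) @ F --> bw_norm d q ^+ 2.
Proof.
move=> pq; rewrite bw_norm_sqr.
under [X in X @ _]eq_fun do rewrite bw_norm_sqr.
by apply: cvg_Re; exact: cvg_bw_dot.
Qed.

Definition cvg_vec (b : T -> 'rV[C]_3) (a : 'rV[C]_3) :=
  forall j, (fun t => b t 0 j : C^o) @ F --> (a 0 j : C^o).

Definition cvg_deriv u (v : deriv3 R) := forall j, cvg_poly (fun t => u t 0 j) (v 0 j).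

Lemma cvg_linform b a : cvg_vec b a -> cvg_poly (fun t => linform (b t)) (linform a).
Proof.
by move=> ba; apply: cvg_poly_sum => j _; exact: (cvg_polyZ (ba j) (@cvg_poly_cst _)).
Qed.

(** The common degree [d] makes the monomial expansion a sum over an index set independent of
    [t]. *)
Lemma cvg_perp d b a p q : cvg_vec b a -> cvg_poly p q ->
  (forall t, homogeneous d (p t)) -> homogeneous d q ->
  cvg_poly (fun t => perp (b t) (p t)) (perp a q).
Proof.
move=> ba pq hp hq.
have E c (r : S) : homogeneous d r -> perp c r =
    \sum_(m : bmultinom 3 d.+1 | mdeg m == d) mcoeff m r *:
      \prod_(j < 3) ('X_j - (c 0 j)^* *: linform c) ^+ (val m) j.
  move=> hr; rewrite {1}(homogeneousE hr) perp_sum; apply: eq_bigr => m _.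
  by rewrite perpZ perpX.
rewrite (E a q hq); under [X in cvg_poly X]eq_fun => t do rewrite (E _ _ (hp t)).
apply: cvg_poly_sum => m _; apply: (cvg_polyZ (pq _)).
apply: cvg_poly_prod => j _; apply: cvg_polyX.
rewrite -scaleNr; under [X in cvg_poly X]eq_fun => t do rewrite -scaleNr.
apply: (cvg_polyD (@cvg_poly_cst _)); apply: cvg_polyZ (cvg_linform ba).
exact: (cvgN (cvg_conj (ba j))).
Qed.

Lemma cvg_contract b a u v : cvg_vec b a -> cvg_deriv u v ->
  cvg_poly (fun t => contract (b t) (u t)) (contract a v).
Proof.
by move=> ba uv; apply: cvg_poly_sum => j _; exact: (cvg_polyZ (ba j) (uv j)).
Qed.

Lemma cvg_res_sqr n (b : 'I_n -> T -> 'rV[C]_3) (a : 'I_n -> 'rV[C]_3) d u v :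
  (forall i, cvg_vec (b i) (a i)) -> cvg_deriv u v ->
  (forall t, E_ d (u t)) -> E_ d v ->
  (fun t => res_sqr (fun i => b i t) d (u t)) @ F --> res_sqr a d v.
Proof.
move=> ba uv hu hv; apply: (cvgM (cvg_cst _)).
apply: cvg_big => [|i _]; first exact: add_continuous.
 apply: cvg_bw_norm_sqr; apply: (cvg_perp (d := d)).
- exact: ba.
- exact: cvg_contract.
- by move=> t; exact: homogeneous_contract.
- exact: homogeneous_contract.
Qed.

Lemma cvg_defining_poly n (b : 'I_n -> T -> 'rV[C]_3) (a : 'I_n -> 'rV[C]_3) :
  (forall i, cvg_vec (b i) (a i)) ->
  cvg_poly (fun t => defining_poly (fun i => b i t)) (defining_poly a).
Proof. by move=> ba; apply: cvg_poly_prod => i _; exact: cvg_linform. Qed.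

Lemma cvg_saito_det u1 u2 v1 v2 : cvg_deriv u1 v1 -> cvg_deriv u2 v2 ->
  cvg_poly (fun t => saito_det (u1 t) (u2 t)) (saito_det v1 v2).
Proof.
move=> h1 h2; apply: cvg_poly_sum => s _; apply: cvg_polyM (@cvg_poly_cst _) _.
apply: cvg_poly_prod => k _; rewrite !mxE; under [X in cvg_poly X]eq_fun do rewrite !mxE.
by elim/ord3P: k => /=; [exact: cvg_poly_cst|exact: h1|exact: h2].
Qed.

End CoefficientwiseConvergence.

(** * Linear bounds on the spheres *)

(* A finite family of linear functionals has a generalized inverse [e]: it
   corrects any [u] into the common kernel. *)
Lemma kernel_retraction (K : fieldType) (V : zmodType) (sc : K -> V -> V)
    (W : set V) (I : finType) (l : I -> V -> K) :
  W 0 -> (forall x y, W x -> W y -> W (x - y)) ->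
  (forall c x, W x -> W (sc c x)) ->
  (forall i x y, l i (x - y) = l i x - l i y) ->
  (forall i c x, l i (sc c x) = c * l i x) ->
  exists e : I -> V, (forall i, W (e i)) /\
    forall u k, W u -> l k (u - \sum_i sc (l i u) (e i)) = 0.
Proof.
move=> W0 WB Wsc lB lsc.
have l0 i : l i 0 = 0 by rewrite -(subrr 0) lB subrr.
have lN i x : l i (- x) = - l i x by rewrite -sub0r lB l0 sub0r.
have lD i x y : l i (x + y) = l i x + l i y by rewrite -{1}[y]opprK lB lN opprK.
have lS i (s : seq I) (F : I -> V) : l i (\sum_(j <- s) F j) = \sum_(j <- s) l i (F j).
  exact: (big_morph (l i) (lD i) (l0 i)).
have WD x y : W x -> W y -> W (x + y).
  by move=> Wx Wy; rewrite -[y]opprK; apply: (WB _ _ Wx); rewrite -sub0r; exact: WB.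
(* Gaussian elimination, one functional at a time. *)
suff: forall s : seq I, uniq s -> exists e : I -> V, (forall i, W (e i)) /\
    forall u k, W u -> k \in s -> l k u - \sum_(i <- s) l i u * l k (e i) = 0.
  move=> /(_ _ (index_enum_uniq I))[e [We He]]; exists e; split=> // u k Wu.
  rewrite lB lS -[RHS](He u k Wu) ?mem_index_enum//; congr (_ - _).
  by apply: eq_bigr => i _; rewrite lsc.
elim=> [_|k s IHs /= /andP[ks us]]; first by exists (fun=> 0); split.
have [e [We He]] := IHs us.
(* Either [l k] takes a nonzero value [c] on some corrected vector, and rescaling it gives [ek] with
   [l k ek = 1] and [l j ek = 0] for [j] in [s]; or [l k] already vanishes after correction. *)
have [[u0 [Wu0 lu0]]|kvanish] := pselect (exists u0, W u0 /\
    l k u0 - \sum_(i <- s) l i u0 * l k (e i) != 0).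
  set c := l k u0 - _ in lu0.
  pose ek := sc c^-1 (u0 - \sum_(i <- s) sc (l i u0) (e i)).
  have lek j : l j ek = c^-1 * (l j u0 - \sum_(i <- s) l i u0 * l j (e i)).
    by rewrite lsc lB lS; congr (_ * (_ - _)); apply: eq_bigr => i _; rewrite lsc.
  have Wek : W ek.
    by apply/Wsc/WB => //; apply: big_ind => // i _; exact: Wsc.
  (* Subtracting [sc (l k (e i)) ek] makes [l k] vanish on the old vectors without changing the
     functionals in [s]. *)
  exists (fun i => if i == k then ek else e i - sc (l k (e i)) ek); split.
    by move=> i; case: ifP => // _; apply: WB => //; exact: Wsc.
  move=> u j Wu; rewrite big_cons eqxx.
  have -> : \sum_(i <- s) l i u * l j (if i == k then ek else e i - sc (l k (e i)) ek)
      = \sum_(i <- s) l i u * l j (e i) - (\sum_(i <- s) l i u * l k (e i)) * l j ek.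
    rewrite mulr_suml -sumrB big_seq [RHS]big_seq; apply: eq_bigr => i si.
    rewrite (negPf (memPn ks i si)) lB lsc mulrBr; congr (_ - _).
    by rewrite mulrA.
  rewrite inE => /orP[/eqP ->|sj].
    by rewrite lek -/c mulVf// !mulr1 subrr addr0 subrr.
  by rewrite lek He// !mulr0 subr0 add0r He.
exists (fun i => if i == k then 0 else e i); split; first by move=> i; case: ifP.
move=> u j Wu; rewrite big_cons eqxx l0 mulr0 add0r.
have -> : \sum_(i <- s) l i u * l j (if i == k then 0 else e i)
    = \sum_(i <- s) l i u * l j (e i).
  rewrite big_seq [RHS]big_seq; apply: eq_bigr => i si.
  by rewrite (negPf (memPn ks i si)).
rewrite inE => /orP[/eqP ->|sj]; last exact: He.
by apply/eqP; apply: contrapT => H; apply: kvanish; exists u; split=> //; exact/negP.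
Qed.

Section SphereBounds.
Variable R : realType.
Local Notation C := R[i].
Local Notation S := (Spoly R).
Implicit Types (d : nat) (p q : S) (u v : deriv3 R).

Definition abs (z : C) : R := complex.Re `|z|.

Lemma absC z : ((abs z)%:C)%C = `|z|.
Proof. exact/ReK/normr_ge0. Qed.

Lemma abs_ge0 z : 0 <= abs z.
Proof. exact/Re_ge0/normr_ge0. Qed.

Lemma absM z w : abs (z * w) = abs z * abs w.
Proof. by apply: (@complexI R); rewrite rmorphM /= !absC normrM. Qed.

Lemma absD z w : abs (z + w) <= abs z + abs w.
Proof. by rewrite -lecR rmorphD /= !absC ler_normD. Qed.

Lemma abs0 : abs 0 = 0.
Proof. by rewrite /abs normr0. Qed.

Lemma abs_sum (I : Type) (r : seq I) (P : pred I) (F : I -> C) :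
  abs (\sum_(i <- r | P i) F i) <= \sum_(i <- r | P i) abs (F i).
Proof.
elim/big_rec2: _ => [|i x y _ xy]; first by rewrite abs0.
by apply: le_trans (absD _ _) _; rewrite lerD2l.
Qed.

Lemma ler_absRe z : `|complex.Re z| <= abs z.
Proof. exact: ler_normRe. Qed.

Lemma ler_absIm z : `|complex.Im z| <= abs z.
Proof.
rewrite /abs normc_def/= -sqrtr_sqr ler_wsqrtr// lerDr; exact: sqr_ge0.
Qed.

Lemma abs_coef_sqr d p m : homogeneous d p ->
  abs (mcoeff m p) ^+ 2 <= (multinomial m)%:R * bw_norm d p ^+ 2.
Proof.
move=> hp; have M0 : 0 < (multinomial m)%:R :> C by rewrite ltr0n multinomial_gt0.
have [md|md] := eqVneq (mdeg m) d; last first.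
  by rewrite (homogeneous_coef hp md) abs0 expr0n/= mulr_ge0// sqr_ge0.
rewrite -lecR rmorphXn [X in _ <= X]rmorphM /= absC bw_norm_sqrC rmorph_nat.
have := bw_dot_coef_le p md; rewrite ler_pdivrMr// => H.
by rewrite normCK [X in _ <= X]mulrC.
Qed.

Lemma sphereE_norm_le d u j : sphereE R d u -> bw_norm d (u 0 j) ^+ 2 <= 1.
Proof.
move=> [hu /(congr1 (fun x => x ^+ 2))]; rewrite expr1n bw_normv_sqr => <-.
by rewrite (bigD1 j)//= lerDl sumr_ge0// => i _; exact: sqr_ge0.
Qed.

Lemma sphereE_coef_le d u j m : sphereE R d u ->
  abs (mcoeff m (u 0 j)) <= (multinomial m)%:R.
Proof.
move=> Su; have hu := Su.1 j.
have M1 : 1 <= (multinomial m)%:R :> R by rewrite ler1n multinomial_gt0.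
have M0 := le_trans ler01 M1.
rewrite -(ler_pXn2r (_ : 0 < 2)%N) ?nnegrE ?abs_ge0//.
apply: le_trans (abs_coef_sqr m hu) _; rewrite expr2 ler_wpM2l//.
exact: le_trans (sphereE_norm_le j Su) M1.
Qed.

(** The module scaling on [deriv3 R] is by polynomials; complex scalars act through constants. *)
Definition scaleC (c : C) u : deriv3 R := mpolyC 3 c *: u.

Lemma scaleCE c u j : scaleC c u 0 j = c *: u 0 j.
Proof. by rewrite mxE mul_mpolyC. Qed.

Definition Clinear (f : deriv3 R -> C) :=
  (forall u v, f (u - v) = f u - f v) /\ (forall c u, f (scaleC c u) = c * f u).

Lemma Clinear0 f : Clinear f -> f 0 = 0.
Proof. by move=> [fB _]; rewrite -(subrr 0) fB subrr. Qed.

Lemma ClinearN f u : Clinear f -> f (- u) = - f u.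
Proof. by move=> lf; rewrite -sub0r lf.1 Clinear0// sub0r. Qed.

Lemma ClinearD f u v : Clinear f -> f (u + v) = f u + f v.
Proof. by move=> lf; rewrite -{1}[v]opprK lf.1 (ClinearN _ lf) opprK. Qed.

Lemma Clinear_sum f (I : Type) (r : seq I) (P : pred I) (F : I -> deriv3 R) :
  Clinear f -> f (\sum_(i <- r | P i) F i) = \sum_(i <- r | P i) f (F i).
Proof.
move=> lf; apply: (big_morph f); last exact: Clinear0.
by move=> u v; exact: ClinearD.
Qed.

Lemma ClinearB f g : Clinear f -> Clinear g -> Clinear (fun u => f u - g u).
Proof.
move=> lf lg; split=> [u v|c u]; first by rewrite lf.1 lg.1; ring.
by rewrite lf.2 lg.2 mulrBr.
Qed.

Lemma Clinear_lcomb (I : Type) (r : seq I) (f : I -> deriv3 R -> C) (k : I -> C) :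
  (forall i, Clinear (f i)) -> Clinear (fun u => \sum_(i <- r) f i u * k i).
Proof.
move=> lf; split=> [u v|c u].
  by rewrite -sumrB; apply: eq_bigr => i _; rewrite (lf i).1 mulrBl.
by rewrite mulr_sumr; apply: eq_bigr => i _; rewrite (lf i).2 mulrA.
Qed.

Definition monomial_deriv (j : 'I_3) (m : multinom 3) : deriv3 R :=
  mpolyX C m *: delta_mx 0 j.

Lemma deriv_expand d u : E_ d u ->
  u = \sum_(j < 3) \sum_(m : bmultinom 3 d.+1 | mdeg m == d)
        scaleC (mcoeff m (u 0 j)) (monomial_deriv j m).
Proof.
move=> hu; apply/rowP => k; rewrite {1}(homogeneousE (hu k)) summxE (bigD1 k)//=.
rewrite [X in _ + X]big1 ?addr0 => [|j jk]; last first.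
  rewrite summxE big1// => m _.
  by rewrite scaleCE !mxE eq_sym (negPf jk) andbF mulr0 scaler0.
rewrite summxE; apply: eq_bigr => m _.
by rewrite scaleCE !mxE !eqxx mulr1.
Qed.

Lemma Clinear_expand d f u : Clinear f -> E_ d u ->
  f u = \sum_(j < 3) \sum_(m : bmultinom 3 d.+1 | mdeg m == d)
          mcoeff m (u 0 j) * f (monomial_deriv j m).
Proof.
move=> lf hu; rewrite {1}(deriv_expand hu) (Clinear_sum _ _ _ lf); apply: eq_bigr => j _.
by rewrite (Clinear_sum _ _ _ lf); apply: eq_bigr => m _; exact: lf.2.
Qed.

(** The bound [B] on basis elements is a parameter so that, for a bilinear form with its second
    argument on a sphere, it can be taken uniform in that argument. *)
Lemma Clinear_bound d f (B : 'I_3 -> multinom 3 -> R) u : Clinear f ->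
  (forall j m, abs (f (monomial_deriv j m)) <= B j m) -> sphereE R d u ->
  abs (f u) <= \sum_(j < 3) \sum_(m : bmultinom 3 d.+1 | mdeg m == d)
                 (multinomial m)%:R * B j m.
Proof.
move=> lf fB Su; rewrite (Clinear_expand lf Su.1).
apply: le_trans (abs_sum _ _ _) _; apply: ler_sum => j _.
apply: le_trans (abs_sum _ _ _) _; apply: ler_sum => m _.
by rewrite absM ler_pM ?abs_ge0// (sphereE_coef_le _ _ Su).
Qed.

Lemma Clinear_bounded d f : Clinear f ->
  exists2 M : R, 0 <= M & forall u, sphereE R d u -> abs (f u) <= M.
Proof.
move=> lf; eexists; last first.
  by move=> u Su; apply: (Clinear_bound lf _ Su) => j m; exact: lexx.
by apply: sumr_ge0 => j _; apply: sumr_ge0 => m _; rewrite mulr_ge0// abs_ge0.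
Qed.

Lemma E_monomial_deriv j m : E_ (mdeg m) (monomial_deriv j m).
Proof.
move=> k; rewrite !mxE eqxx/=; case: eqP => _; last by rewrite mulr0; exact: homogeneous0.
by rewrite mulr1; exact: homogeneousX.
Qed.

Lemma E_sub d u v : E_ d u -> E_ d v -> E_ d (u - v).
Proof. by move=> hu hv j; rewrite !mxE; apply: homogeneousB; [exact: hu|exact: hv]. Qed.

Lemma E_scale d c u : E_ d u -> E_ d (scaleC c u).
Proof. by move=> hu j; rewrite scaleCE; apply: homogeneousZ; exact: hu. Qed.

Lemma E_0 d : E_ d (0 : deriv3 R).
Proof. by move=> j; rewrite mxE; exact: homogeneous0. Qed.

Lemma E_add d u v : E_ d u -> E_ d v -> E_ d (u + v).
Proof.
by move=> hu hv j; rewrite mxE; apply: homogeneousD; [exact: hu|exact: hv].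
Qed.

Lemma E_lcomb d (I : finType) (c : I -> C) (e : I -> deriv3 R) :
  (forall i, E_ d (e i)) -> E_ d (\sum_i scaleC (c i) (e i)).
Proof.
move=> he; apply: big_ind => [|u v|i _]; [exact: E_0|exact: E_add|].
exact/E_scale/he.
Qed.

Lemma Cbilinear_bounded d1 d2 (b : deriv3 R -> deriv3 R -> C) :
  (forall v, Clinear (b^~ v)) -> (forall u, Clinear (b u)) ->
  exists2 M : R, 0 <= M &
    forall u v, sphereE R d1 u -> sphereE R d2 v -> abs (b u v) <= M.
Proof.
move=> bl br.
have /choice[B HB] : forall jm : 'I_3 * multinom 3, exists M : R, 0 <= M /\
    forall v, sphereE R d2 v -> abs (b (monomial_deriv jm.1 jm.2) v) <= M.
  move=> jm.
  by have [M M0 HM] := Clinear_bounded d2 (br (monomial_deriv jm.1 jm.2)); exists M.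
pose M := \sum_(j < 3) \sum_(m : bmultinom 3 d1.+1 | mdeg m == d1)
  (multinomial m)%:R * B (j, val m).
exists M => [|u v Su Sv].
  apply: sumr_ge0 => j _; apply: sumr_ge0 => m _; rewrite mulr_ge0//.
  exact: (HB (j, val m)).1.
apply: (Clinear_bound (f := b^~ v) (B := fun j m => B (j, m)) _ _ Su) => // j m.
exact: (HB (j, m)).2.
Qed.

Section KernelEstimate.
Variables (d1 d2 : nat) (I1 I2 : finType).
Variables (l1 : I1 -> deriv3 R -> C) (l2 : I2 -> deriv3 R -> C).
Variable b : deriv3 R -> deriv3 R -> C.
Hypothesis l1P : forall i, Clinear (l1 i).
Hypothesis l2P : forall i, Clinear (l2 i).
Hypothesis bl : forall v, Clinear (b^~ v).
Hypothesis br : forall u, Clinear (b u).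
Hypothesis b0 : forall u v, E_ d1 u -> E_ d2 v ->
  (forall i, l1 i u = 0) -> (forall i, l2 i v = 0) -> b u v = 0.

(** Correct [u] and [v] into the two kernels by [kernel_retraction]. Expanding [b u' v' = 0] for the
    corrected pair writes [b u v] as a combination of the [l1 i u] and [l2 j v], with coefficients
    bounded on the spheres. *)
Lemma bilinear_kernel_bound : exists2 M : R, 0 <= M &
  forall u v, sphereE R d1 u -> sphereE R d2 v ->
    abs (b u v) <= M * (\sum_i abs (l1 i u) + \sum_i abs (l2 i v)).
Proof.
have [e1 [E1 He1]] := @kernel_retraction C (deriv3 R) scaleC (@E_ R d1) I1 l1
  (@E_0 d1) (@E_sub d1) (@E_scale d1) (fun i => (l1P i).1) (fun i => (l1P i).2).
have [e2 [E2 He2]] := @kernel_retraction C (deriv3 R) scaleC (@E_ R d2) I2 l2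
  (@E_0 d2) (@E_sub d2) (@E_scale d2) (fun i => (l2P i).1) (fun i => (l2P i).2).
(* The value of [b] at the corrected [u] and at [e2 j]. *)
pose pb u j := b u (e2 j) - \sum_i l1 i u * b (e1 i) (e2 j).
have Epi u : E_ d1 u -> E_ d1 (u - \sum_i scaleC (l1 i u) (e1 i)).
  by move=> hu; exact: (E_sub hu (E_lcomb _ E1)).
have Epi' v : E_ d2 v -> E_ d2 (v - \sum_i scaleC (l2 i v) (e2 i)).
  by move=> hv; exact: (E_sub hv (E_lcomb _ E2)).
have bE u v : E_ d1 u -> E_ d2 v ->
    b u v = \sum_i l1 i u * b (e1 i) v + \sum_j l2 j v * pb u j.
  move=> hu hv.
  have b1 w : b (u - \sum_i scaleC (l1 i u) (e1 i)) w
      = b u w - \sum_i l1 i u * b (e1 i) w.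
    rewrite (bl w).1 (Clinear_sum _ _ _ (bl w)); congr (_ - _).
    by apply: eq_bigr => i _; rewrite (bl w).2.
  have := b0 (Epi u hu) (Epi' v hv) (fun i => He1 u i hu) (fun i => He2 v i hv).
  rewrite (br _).1 (Clinear_sum _ _ _ (br _)) b1 => /eqP; rewrite !subr_eq add0r.
  move=> /eqP ->; rewrite addrC; congr (_ + _); apply: eq_bigr => j _.
  by rewrite (br _).2 b1.
have /choice[M1 HM1] : forall i, exists M : R, 0 <= M /\
    forall v, sphereE R d2 v -> abs (b (e1 i) v) <= M.
  by move=> i; have [M M0 HM] := Clinear_bounded d2 (br (e1 i)); exists M.
have /choice[M2 HM2] : forall j, exists M : R, 0 <= M /\
    forall u, sphereE R d1 u -> abs (pb u j) <= M.
  move=> j; have lpb : Clinear (pb^~ j).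
    by apply: ClinearB; [exact: bl|exact: Clinear_lcomb].
  by have [M M0 HM] := Clinear_bounded d1 lpb; exists M.
pose M := \sum_i M1 i + \sum_j M2 j.
have M10 : 0 <= \sum_i M1 i by apply: sumr_ge0 => i _; exact: (HM1 i).1.
have M20 : 0 <= \sum_j M2 j by apply: sumr_ge0 => j _; exact: (HM2 j).1.
exists M => [|u v Su Sv]; first exact: addr_ge0.
rewrite (bE u v Su.1 Sv.1); apply: le_trans (absD _ _) _; rewrite mulrDr.
apply: lerD; apply: le_trans (abs_sum _ _ _) _; rewrite mulr_sumr; apply: ler_sum => i _;
  rewrite absM mulrC ler_wpM2r ?abs_ge0//.
- apply: le_trans ((HM1 i).2 v Sv) _; rewrite /M (bigD1 i)//= -addrA lerDl.
  by rewrite addr_ge0// sumr_ge0// => k _; exact: (HM1 k).1.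
- apply: le_trans ((HM2 i).2 u Su) _; rewrite /M addrC (bigD1 i)//= -addrA lerDl.
  by rewrite addr_ge0// sumr_ge0// => k _; exact: (HM2 k).1.
Qed.

End KernelEstimate.
End SphereBounds.

(** * Multilinearity and range of the Saito determinant *)

Section Rows.
Variable K : comPzRingType.
Implicit Types x y z w : 'I_3 -> K.

Definition det_rows x y z : K :=
  \det (\matrix_(k < 3, j < 3) nth 0 [:: x j; y j; z j] k).

Lemma det_rowsE x y z : det_rows x y z =
  x 0 * (y 1 * z 2%:R - y 2%:R * z 1) - x 1 * (y 0 * z 2%:R - y 2%:R * z 0)
  + x 2%:R * (y 0 * z 1 - y 1 * z 0).
Proof. by rewrite /det_rows det_mx33 !mxE. Qed.

Lemma det_rowsB2 x y y' w z : (forall j, w j = y j - y' j) ->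
  det_rows x w z = det_rows x y z - det_rows x y' z.
Proof. by move=> wE; rewrite !det_rowsE !wE; ring. Qed.

Lemma det_rowsB3 x y z z' w : (forall j, w j = z j - z' j) ->
  det_rows x y w = det_rows x y z - det_rows x y z'.
Proof. by move=> wE; rewrite !det_rowsE !wE; ring. Qed.

Lemma det_rowsM2 x y w z c : (forall j, w j = c * y j) ->
  det_rows x w z = c * det_rows x y z.
Proof. by move=> wE; rewrite !det_rowsE !wE; ring. Qed.

Lemma det_rowsM3 x y z w c : (forall j, w j = c * z j) ->
  det_rows x y w = c * det_rows x y z.
Proof. by move=> wE; rewrite !det_rowsE !wE; ring. Qed.

(** Choose [(i, j, k)] cyclic, so that the sign is positive. *)
Lemma det_rows_delta x (f g : K) (i : 'I_3) : exists j k : 'I_3,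
  forall y z, (forall l, y l = f * (l == j)%:R) -> (forall l, z l = g * (l == k)%:R) ->
  det_rows x y z = x i * (f * g).
Proof.
elim/ord3P: i.
- by exists 1, 2%:R => y z yE zE; rewrite det_rowsE !yE !zE/=; ring.
- by exists 2%:R, 0 => y z yE zE; rewrite det_rowsE !yE !zE/=; ring.
- by exists 0, 1 => y z yE zE; rewrite det_rowsE !yE !zE/=; ring.
Qed.

End Rows.

Lemma multinom_split (m : multinom 3) d1 d2 : mdeg m = (d1 + d2)%N ->
  exists m1 m2, [/\ m = mnm_add m1 m2, mdeg m1 = d1 & mdeg m2 = d2].
Proof.
elim: d1 m => [|d1 IH] m md.
  by exists (@mnm0 3), m; rewrite add0m mdeg0.
have [|j [m' mE]] := @multinom_pick m; first by rewrite md.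
have [|m1 [m2 [m'E dm1 dm2]]] := IH m'.
  by move: md; rewrite mE mdegD mdeg1 add1n => -[].
exists (mnm_add (mnm1 j) m1), m2; split=> //; first by rewrite mE m'E addmA.
by rewrite mdegD mdeg1 dm1.
Qed.

Section SaitoDeterminant.
Variable R : realType.
Local Notation C := R[i].
Local Notation S := (Spoly R).
Local Notation "''X_' j" := (mpolyX C (mnm1 j))
  (at level 8, j at level 2, format "''X_' j").
Implicit Types (d : nat) (p q : S) (u v w : deriv3 R).

Lemma realC_eq0 (x : R) : ((x%:C)%C == 0 :> C) = (x == 0).
Proof. by rewrite eq_complex/= eqxx andbT. Qed.

Lemma saito_detE u v :
  saito_det u v = det_rows (fun j => 'X_j) (fun j => u 0 j) (fun j => v 0 j).
Proof. by []. Qed.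

Lemma saito_detBl u u' v : saito_det (u - u') v = saito_det u v - saito_det u' v.
Proof. by rewrite !saito_detE; apply: det_rowsB2 => j; rewrite !mxE. Qed.

Lemma saito_detBr u v v' : saito_det u (v - v') = saito_det u v - saito_det u v'.
Proof. by rewrite !saito_detE; apply: det_rowsB3 => j; rewrite !mxE. Qed.

Lemma saito_detZl c u v : saito_det (scaleC c u) v = c *: saito_det u v.
Proof.
by rewrite !saito_detE -mul_mpolyC; apply: det_rowsM2 => j; rewrite scaleCE mul_mpolyC.
Qed.

Lemma saito_detZr c u v : saito_det u (scaleC c v) = c *: saito_det u v.
Proof.
by rewrite !saito_detE -mul_mpolyC; apply: det_rowsM3 => j; rewrite scaleCE mul_mpolyC.
Qed.

(** Split the monomial into a variable and factors of degrees [d1] and [d2]. This is the source of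
    pairs with nonzero pairing on any arrangement. *)
Lemma saito_det_monomials d1 d2 m : mdeg m = (d1 + d2 + 1)%N ->
  exists u v, [/\ E_ d1 u, E_ d2 v & saito_det u v = mpolyX C m].
Proof.
move=> md; have [|i [m' mE]] := @multinom_pick m; first by rewrite md addn1.
have [|m1 [m2 [m'E dm1 dm2]]] := @multinom_split m' d1 d2.
  by move: md; rewrite mE mdegD mdeg1 add1n addn1 => -[].
have [j [k jkE]] := det_rows_delta (fun j : 'I_3 => 'X_j : S)
  (mpolyX C m1) (mpolyX C m2) i.
exists (monomial_deriv R j m1), (monomial_deriv R k m2); split.
- by rewrite -dm1; exact: E_monomial_deriv.
- by rewrite -dm2; exact: E_monomial_deriv.
rewrite saito_detE jkE => [|l|l]; rewrite ?mxE ?eqxx//.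
by rewrite mE m'E !mpolyXD.
Qed.

Definition normalize d u := scaleC (((bw_normv d u)^-1)%:C)%C u.

Lemma bw_normvZ d c u : bw_normv d (scaleC c u) = abs c * bw_normv d u.
Proof.
apply/eqP; rewrite -(eqrXn2 (_ : 0 < 2)%N) ?mulr_ge0 ?sqrtr_ge0 ?abs_ge0//; apply/eqP.
rewrite exprMn !bw_normv_sqr mulr_sumr; apply: eq_bigr => j _.
by rewrite scaleCE bw_normZ exprMn.
Qed.

Lemma bw_normv_neq0 d u : E_ d u -> u != 0 -> bw_normv d u != 0.
Proof.
move=> hu; apply: contra => /eqP u0.
have : \sum_(j < 3) bw_norm d (u 0 j) ^+ 2 = 0 by rewrite -bw_normv_sqr u0 expr0n.
move=> /psumr_eq0P H; apply/eqP/rowP => j; rewrite mxE.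
apply: (bw_dot_eq0 (hu j)); rewrite -bw_norm_sqrC H// => k _; exact: sqr_ge0.
Qed.

Lemma sphereE_normalize d u : E_ d u -> u != 0 -> sphereE R d (normalize d u).
Proof.
move=> hu u0; split; first exact: E_scale.
rewrite bw_normvZ /abs Re_norm_real ger0_norm ?invr_ge0 ?sqrtr_ge0// mulVf//.
exact: bw_normv_neq0.
Qed.

Lemma saito_det_normalize d1 d2 u v : E_ d1 u -> E_ d2 v -> saito_det u v != 0 ->
  [/\ sphereE R d1 (normalize d1 u), sphereE R d2 (normalize d2 v) &
   exists2 c : C, c != 0 &
     saito_det (normalize d1 u) (normalize d2 v) = c *: saito_det u v].
Proof.
move=> hu hv B0.
have u0 : u != 0.
  by apply: contraNneq B0 => ->; rewrite -(subrr 0) saito_detBl subrr.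
have v0 : v != 0.
  by apply: contraNneq B0 => ->; rewrite -(subrr 0) saito_detBr subrr.
split; [exact: sphereE_normalize|exact: sphereE_normalize|].
rewrite /normalize saito_detZl saito_detZr scalerA; eexists; last by [].
by apply: mulf_neq0; rewrite realC_eq0 invr_eq0; exact: bw_normv_neq0.
Qed.

End SaitoDeterminant.

(** * Estimates on Gamma *)

Lemma contractB (R : realType) (a : 'rV[R[i]]_3) (u v : deriv3 R) :
  contract a (u - v) = contract a u - contract a v.
Proof.
by rewrite /contract -sumrB; apply: eq_bigr => j _; rewrite !mxE scalerBr.
Qed.

Lemma contractZ (R : realType) (a : 'rV[R[i]]_3) c (u : deriv3 R) :
  contract a (scaleC c u) = c *: contract a u.
Proof.
rewrite /contract scaler_sumr; apply: eq_bigr => j _.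
by rewrite scaleCE !scalerA mulrC.
Qed.

(** Passes from a bound linear in residual norms to one linear in their squares, by
    [(x + y)^2 <= 2 (x^2 + y^2)]. *)
Lemma sqr_bound_of_sqrt (R : realType) (t p q M K L : R) :
  0 <= t -> 0 <= p -> 0 <= q -> 0 <= M -> 0 <= K -> 0 <= L ->
  t <= M * (K * Num.sqrt p + L * Num.sqrt q) ->
  t ^+ 2 <= (M * (K + L)) ^+ 2 * 2 * (p + q).
Proof.
move=> t0 p0 q0 M0 K0 L0 tle.
rewrite -[p]sqr_sqrtr// -[q]sqr_sqrtr//.
move: (Num.sqrt p) (Num.sqrt q) (sqrtr_ge0 p) (sqrtr_ge0 q) tle => x y x0 y0 tle.
have H : t <= M * (K + L) * (x + y).
  by apply: le_trans tle _; rewrite -mulrA ler_wpM2l//; nra.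
apply: (@le_trans _ _ ((M * (K + L) * (x + y)) ^+ 2)).
  by rewrite ler_pXn2r ?nnegrE// !(mulr_ge0, addr_ge0).
rewrite exprMn -mulrA ler_wpM2l ?sqr_ge0//.
by have := sqr_ge0 (x - y); nra.
Qed.

Section GammaEstimates.
Variables (R : realType) (n d1 d2 : nat) (a : 'I_n -> 'rV[R[i]]_3).
Hypothesis nE : (d1 + d2 + 1)%N = n.
Hypothesis a1 : forall i, form_dot (a i) (a i) = 1.
Hypothesis aI : forall i j (c : R[i]), a i = c *: a j -> i = j.
Variable beta : R.
Hypotheses (beta0 : 0 < beta) (beta1 : beta < 1).
Local Notation C := R[i].
Local Notation S := (Spoly R).
Local Notation Q := (defining_poly a).
Implicit Types (u v : deriv3 R) (lambda : R).

Definition pairing u v : C := bw_dot n (saito_det u v) (q_ a).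

Definition total_res u v : R := res_sqr a d1 u + res_sqr a d2 v.

Lemma n_gt0 : (0 < n)%N. Proof. by rewrite -nE addn1. Qed.

Lemma normQ_gt0 : 0 < bw_norm n Q.
Proof.
by apply: bw_norm_gt0; [exact: homogeneous_defining_poly|exact: defining_poly_neq0].
Qed.

Lemma Q_scale_q : Q = ((bw_norm n Q)%:C)%C *: q_ a.
Proof.
rewrite /q_ scalerA -rmorphM /= divff ?gt_eqF ?normQ_gt0//.
by rewrite [_%:C%C]rmorph1 scale1r.
Qed.

Lemma bw_dot_q : bw_dot n (q_ a) (q_ a) = 1.
Proof.
rewrite bw_dotZl bw_dotZr -bw_norm_sqrC; have := normQ_gt0; move: (bw_norm n Q) => x x0.
by rewrite conj_realC -!rmorphM/= mulrA -expr2 -exprMn mulVf ?gt_eqF// expr1n.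
Qed.

Lemma pairing_linl v : Clinear (pairing^~ v).
Proof.
split=> [u u'|c u]; first by rewrite /pairing saito_detBl bw_dotDl bw_dotNl.
by rewrite /pairing saito_detZl bw_dotZl.
Qed.

Lemma pairing_linr u : Clinear (pairing u).
Proof.
split=> [v v'|c v]; first by rewrite /pairing saito_detBr bw_dotDl bw_dotNl.
by rewrite /pairing saito_detZr bw_dotZl.
Qed.

Lemma pairing_le u v : abs (pairing u v) ^+ 2 <= bw_norm n (saito_det u v) ^+ 2.
Proof.
rewrite -lecR bw_norm_sqrC rmorphXn /= absC; apply: bw_dot_unit_le.
exact: bw_dot_q.
Qed.

Lemma total_res_ge0 u v : 0 <= total_res u v.
Proof. by rewrite addr_ge0// res_sqr_ge0. Qed.

Definition denom lambda u v : R :=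
  bw_norm n (saito_det u v) ^+ 2 + lambda * total_res u v `^ beta.

Lemma GammaE lambda u v : E_ d1 u -> E_ d2 v ->
  Gamma lambda beta a d1 d2 u v =
  if 0 < denom lambda u v then abs (pairing u v) ^+ 2 / denom lambda u v else 0.
Proof. by move=> hu hv; rewrite /Gamma R_E. Qed.

Lemma denom_ge lambda u v : 0 <= lambda ->
  abs (pairing u v) ^+ 2 <= denom lambda u v.
Proof.
move=> l0; apply: le_trans (pairing_le u v) _.
by rewrite lerDl mulr_ge0// powR_ge0.
Qed.

Lemma Gamma_ge0 lambda u v : E_ d1 u -> E_ d2 v ->
  0 <= Gamma lambda beta a d1 d2 u v.
Proof.
move=> hu hv; rewrite GammaE//; case: ifPn => // d0.
by rewrite divr_ge0 ?sqr_ge0// ltW.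
Qed.

Lemma Gamma_le1 lambda u v : 0 <= lambda -> E_ d1 u -> E_ d2 v ->
  Gamma lambda beta a d1 d2 u v <= 1.
Proof.
move=> l0 hu hv; rewrite GammaE//; case: ifPn => // d0.
by rewrite ler_pdivrMr// mul1r denom_ge.
Qed.

(** Equality of numerator and denominator, with Cauchy-Schwarz, leaves no room for the penalty: the
    residuals vanish. Positivity of the denominator then gives a nonzero determinant. *)
Lemma Gamma_eq1_free lambda u v : 0 < lambda -> E_ d1 u -> E_ d2 v ->
  Gamma lambda beta a d1 d2 u v = 1 -> free_forms d1 d2 a.
Proof.
move=> l0 hu hv; rewrite GammaE//; case: ifPn => [d0|_ /eqP]; last first.
  by rewrite eq_sym oner_eq0.
move=> /eqP; rewrite -subr_eq0 -[X in _ - X](divff (lt0r_neq0 d0)) -mulrBl mulf_eq0.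
rewrite invr_eq0 (gt_eqF d0) orbF subr_eq0 => /eqP E.
have r0 : total_res u v = 0.
  apply: (@powR_eq0_eq0 _ _ beta); apply/eqP.
  have := pairing_le u v; rewrite E /denom gerDl pmulr_rle0// => r0.
  by rewrite eq_le r0 powR_ge0.
have /andP[/eqP ru /eqP rv] : (res_sqr a d1 u == 0) && (res_sqr a d2 v == 0).
  by rewrite -paddr_eq0 ?res_sqr_ge0//; apply/eqP.
have Du := (res_sqr_eq0 n_gt0 a1 hu).1 ru.
have Dv := (res_sqr_eq0 n_gt0 a1 hv).1 rv.
apply: (saito_det_neq0_free nE a1 aI hu hv Du Dv).
apply: contraTneq d0 => B0.
by rewrite /denom B0 r0 powR0 ?gt_eqF// mulr0 addr0 bw_norm_sqr bw_dot0l ltxx.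
Qed.

Lemma free_Gamma_eq1 : free_forms d1 d2 a ->
  exists u v, [/\ sphereE R d1 u, sphereE R d2 v &
    forall lambda, Gamma lambda beta a d1 d2 u v = 1].
Proof.
move=> /(free_saito_det_neq0 a1)[u0 [v0 [hu0 hv0 Du0 Dv0 B0]]].
have [Su Sv [c c0 BE]] := saito_det_normalize hu0 hv0 B0.
set u := normalize d1 u0 in Su BE; set v := normalize d2 v0 in Sv BE.
exists u, v; split=> // lambda.
have logZ (w : deriv3 R) x : log_derivations a w -> log_derivations a (scaleC x w).
  move=> /(log_derivationsP _ a1) Dw; apply/(log_derivationsP _ a1) => i.
  by rewrite contractZ perpZ Dw scaler0.
have r0 : total_res u v = 0.
  have ru := (res_sqr_eq0 n_gt0 a1 Su.1).2 (logZ _ _ Du0).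
  have rv := (res_sqr_eq0 n_gt0 a1 Sv.1).2 (logZ _ _ Dv0).
  by rewrite /total_res ru rv addr0.
have [k kE] := saito_det_log nE a1 aI hu0 hv0 Du0 Dv0.
have BQ : saito_det u v = (c * k * ((bw_norm n Q)%:C)%C) *: q_ a.
  by rewrite BE kE [X in _ *: (_ *: X) = _]Q_scale_q !scalerA.
have B1 : 0 < bw_norm n (saito_det u v) ^+ 2.
  apply/exprn_gt0/bw_norm_gt0.
    by rewrite -nE; apply: homogeneous_saito_det; [exact: Su.1|exact: Sv.1].
  by rewrite BE scaler_eq0 negb_or c0 B0.
have dE : denom lambda u v = bw_norm n (saito_det u v) ^+ 2.
  by rewrite /denom r0 powR0 ?gt_eqF// mulr0 addr0.
rewrite (GammaE _ Su.1 Sv.1) dE B1.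
suff -> : abs (pairing u v) ^+ 2 = bw_norm n (saito_det u v) ^+ 2.
  by rewrite divff// gt_eqF.
apply: (@complexI R); rewrite bw_norm_sqrC rmorphXn /= absC /pairing BQ.
move: (q_ a) bw_dot_q => q qq.
by rewrite !bw_dotZl bw_dotZr qq !mulr1 normCK.
Qed.

(** Take a monomial occurring in [q_ a] and a pair whose determinant is that monomial. The pair does
    not depend on [lambda]. *)
Lemma Gamma_gt0 : exists u v, [/\ sphereE R d1 u, sphereE R d2 v &
  forall lambda, 0 < lambda -> 0 < Gamma lambda beta a d1 d2 u v].
Proof.
have [m md qm] : exists2 m, mdeg m = n & mcoeff m (q_ a) != 0.
  have hq : homogeneous n (q_ a).
    by apply: homogeneousZ; exact: homogeneous_defining_poly.
  apply: contrapT => H; have q0 : q_ a = 0.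
    apply/mpolyP => m; rewrite mcoeff0; apply/eqP.
    rewrite -[_ == _]negbK; apply/negP => qm.
    apply: H; exists m => //; apply/eqP; apply: contraNT qm => /(homogeneous_coef hq) ->.
    by rewrite eqxx.
  by have := bw_dot_q; rewrite q0 bw_dot0l => /eqP; rewrite eq_sym oner_eq0.
have [|u0 [v0 [hu0 hv0 BX]]] := @saito_det_monomials R d1 d2 m; first by rewrite nE.
have B0 : saito_det u0 v0 != 0.
  by rewrite BX; apply: contraNneq (oner_neq0 C) => /(congr1 (mcoeff m));
    rewrite mcoeffX eqxx mcoeff0 => /eqP.
have [Su Sv [c c0 BE]] := saito_det_normalize hu0 hv0 B0.
exists (normalize d1 u0), (normalize d2 v0); split; [exact: Su|exact: Sv|] => lambda l0.
rewrite (GammaE _ Su.1 Sv.1).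
have p0 : 0 < abs (pairing (normalize d1 u0) (normalize d2 v0)) ^+ 2.
  rewrite exprn_gt0// lt_neqAle abs_ge0 andbT eq_sym.
  rewrite -realC_eq0 absC normr_eq0 /pairing BE BX bw_dotZl (bw_dotXl _ md).
  rewrite !mulf_eq0 negb_or c0 /= invr_eq0 conjC_eq0 (negPf qm)/= pnatr_eq0.
  by rewrite -lt0n multinomial_gt0.
have d0 := lt_le_trans p0 (denom_ge (normalize d1 u0) (normalize d2 v0) (ltW l0)).
by rewrite d0 divr_gt0.
Qed.

Hypothesis notfree : ~ free_forms d1 d2 a.

Lemma pairing_bound : exists2 M : R, 0 < M & forall u v,
  sphereE R d1 u -> sphereE R d2 v ->
  abs (pairing u v) ^+ 2 <= M * total_res u v /\
  abs (pairing u v) ^+ 2 <= M * total_res u v `^ beta.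
Proof.
pose l d (k : 'I_n * bmultinom 3 d.+1) u : C :=
  mcoeff (val k.2) (perp (a k.1) (contract (a k.1) u)).
have lP d k : Clinear (@l d k).
  rewrite /l; split=> [u v|c u].
    by rewrite contractB perpB mcoeffB.
  by rewrite contractZ perpZ mcoeffZ.
have l0 d u : E_ d u -> (forall k, @l d k u = 0) -> log_derivations a u.
  move=> hu lu; apply/(log_derivationsP _ a1) => i; apply/mpolyP => m; rewrite mcoeff0.
  have [md|md] := eqVneq (mdeg m) d; last first.
    by apply: homogeneous_coef md; exact/homogeneous_perp/homogeneous_contract.
  have mlt : (mdeg m < d.+1)%N by rewrite md.
  exact: (lu (i, BMultinom mlt)).
have ll d k u : E_ d u -> abs (@l d k u) ^+ 2 <=
    (multinomial (val k.2))%:R * (n%:R * res_sqr a d u).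
  move=> hu; have hp : homogeneous d (perp (a k.1) (contract (a k.1) u)).
    exact/homogeneous_perp/homogeneous_contract.
  apply: le_trans (abs_coef_sqr _ hp) _; rewrite ler_wpM2l//.
  rewrite /res_sqr mulrA divff ?mul1r ?pnatr_eq0 -?lt0n ?n_gt0//.
  rewrite (bigD1 k.1)//= lerDl; apply: sumr_ge0 => i _; exact: sqr_ge0.
have [M1 M10 HM1] : exists2 M : R, 0 <= M & forall u v,
    sphereE R d1 u -> sphereE R d2 v -> abs (pairing u v) <=
    M * (\sum_k abs (@l d1 k u) + \sum_k abs (@l d2 k v)).
  apply: bilinear_kernel_bound;
    [exact: lP|exact: lP|exact: pairing_linl|exact: pairing_linr|].
  (* Non-freeness enters here: in the common kernel both derivations are logarithmic, so their
     determinant must vanish. *)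
  move=> u v hu hv lu lv; rewrite /pairing.
  have [->|B0] := eqVneq (saito_det u v) 0; first by rewrite bw_dot0l.
  case: notfree.
  exact: (saito_det_neq0_free nE a1 aI hu hv (l0 _ _ hu lu) (l0 _ _ hv lv) B0).
have sl d : exists2 K : R, 0 <= K & forall u, E_ d u ->
    \sum_k abs (@l d k u) <= K * Num.sqrt (res_sqr a d u).
  exists (\sum_(k : 'I_n * bmultinom 3 d.+1)
    Num.sqrt ((multinomial (val k.2))%:R * n%:R)).
    by apply: sumr_ge0 => k _; exact: sqrtr_ge0.
  move=> u hu; rewrite mulr_suml; apply: ler_sum => k _.
  rewrite -sqrtrM ?mulr_ge0// -[leLHS]ger0_norm ?abs_ge0// -sqrtr_sqr.
  by rewrite ler_wsqrtr// -mulrA ll.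
have [K1 K10 HK1] := sl d1; have [K2 K20 HK2] := sl d2.
have [M2 M20 HM2] := Cbilinear_bounded d1 d2 pairing_linl pairing_linr.
pose M3 := (M1 * (K1 + K2)) ^+ 2 * 2.
(* [M3] serves for residual at most 1, [M2 ^+ 2] beyond, and the final 1 makes [M] positive. *)
pose M := M3 + M2 ^+ 2 + 1.
have M30 : 0 <= M3 by rewrite mulr_ge0// sqr_ge0.
have M0 : 0 < M by rewrite ltr_wpDl// addr_ge0// sqr_ge0.
have bnd1 u v : sphereE R d1 u -> sphereE R d2 v ->
    abs (pairing u v) ^+ 2 <= M3 * total_res u v.
  move=> Su Sv; apply: sqr_bound_of_sqrt => //;
    [exact: abs_ge0|exact: res_sqr_ge0|exact: res_sqr_ge0|].
  apply: le_trans (HM1 u v Su Sv) _; apply: (ler_wpM2l M10).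
  exact: (lerD (HK1 u Su.1) (HK2 v Sv.1)).
exists M => // u v Su Sv; have r0 := total_res_ge0 u v; split.
  apply: le_trans (bnd1 u v Su Sv) _; rewrite ler_wpM2r//.
  by rewrite /M -addrA lerDl addr_ge0// sqr_ge0.
(* Below 1 the residual is at most its power [beta]; above 1 that power is at least 1 and
   boundedness of the pairing suffices. *)
have [r1|r1] := leP (total_res u v) 1.
  apply: le_trans (bnd1 u v Su Sv) _; apply: ler_pM => //.
    by rewrite /M -addrA lerDl addr_ge0// sqr_ge0.
  have [->|rn0] := eqVneq (total_res u v) 0; first exact: powR_ge0.
  by apply: ger1_powR; rewrite ?(ltW beta1)// r1 lt_neqAle eq_sym rn0 r0.
apply: (@le_trans _ _ (M * 1)); last first.
  apply: (ler_wpM2l (ltW M0)).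
  have -> : 1 = 1 `^ beta :> R by rewrite powR1.
  by rewrite ge0_ler_powR ?nnegrE ?(ltW beta0) ?(ltW r1).
rewrite mulr1 /M addrAC -[leLHS]add0r lerD//; first by rewrite addr_ge0.
by rewrite ler_pXn2r ?nnegrE ?abs_ge0// HM2.
Qed.

End GammaEstimates.

Section PowerContinuity.
Variables (R : realType) (beta : R).
Hypothesis beta0 : 0 < beta.

Lemma cvg_powR (T : Type) (F : set_system T) (FF : Filter F) (x : T -> R) (l : R) :
  (forall t, 0 <= x t) -> 0 <= l -> x @ F --> l ->
  (fun t => x t `^ beta) @ F --> l `^ beta.
Proof.
move=> x0 l0 xl; have [ln0|lneq0] := eqVneq l 0; last first.
  have lpos : 0 < l by rewrite lt_neqAle eq_sym lneq0 l0.
  apply: (@continuous_cvg _ _ _ F FF x (fun y => y `^ beta) l _ xl).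
  apply: differentiable_continuous; apply/derivable1_diffP.
  by apply: derivable_powR; rewrite in_itv/= andbT.
rewrite ln0 powR0 ?gt_eqF//; rewrite ln0 in xl; apply/cvgr0Pnorm_lt => e e0.
have eb0 : 0 < e `^ beta^-1 by rewrite powR_gt0.
near=> t; rewrite ger0_norm ?powR_ge0//.
have xlt : x t < e `^ beta^-1.
  rewrite -[ltLHS]ger0_norm//; near: t.
  by move/cvgr0Pnorm_lt: xl; apply.
have -> : e = (e `^ beta^-1) `^ beta.
  by rewrite -powRrM mulVf ?gt_eqF// powRr1// ltW.
by apply: gt0_ltr_powR => //; rewrite nnegrE// ltW.
Unshelve. all: by end_near. Qed.

End PowerContinuity.

(** * Continuity of Gamma where its denominator is positive *)

Section GammaContinuity.
Variables (R : realType) (T : Type) (F : set_system T).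
Hypothesis FF : Filter F.
Variables (n d1 d2 : nat) (a : 'I_n -> 'rV[R[i]]_3) (b : 'I_n -> T -> 'rV[R[i]]_3).
Hypothesis a1 : forall i, form_dot (a i) (a i) = 1.
Hypothesis b1 : \forall t \near F, forall i, form_dot (b i t) (b i t) = 1.
Hypothesis ba : forall i, cvg_vec F (b i) (a i).
Variables (u v : T -> deriv3 R) (u0 v0 : deriv3 R).
Hypotheses (hu : forall t, E_ d1 (u t)) (hv : forall t, E_ d2 (v t)).
Hypotheses (hu0 : E_ d1 u0) (hv0 : E_ d2 v0).
Hypotheses (uu0 : cvg_deriv F u u0) (vv0 : cvg_deriv F v v0).
Variables (beta lambda : R).
Hypothesis beta0 : 0 < beta.
Local Notation C := R[i].
Local Notation a_ t := (fun i => b i t).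

Lemma cvg_bw_norm d (p : T -> Spoly R) q : cvg_poly F p q ->
  (fun t => bw_norm d (p t)) @ F --> bw_norm d q.
Proof.
move=> pq; apply: (@continuous_cvg _ _ _ F FF _ Num.sqrt); first exact: sqrt_continuous.
by apply: cvg_Re => //; exact: cvg_bw_dot.
Qed.

Lemma cvg_abs (z : T -> C) (l : C) : (z : T -> C^o) @ F --> (l : C^o) ->
  (fun t => abs (z t)) @ F --> abs l.
Proof.
by move=> zl; apply: cvg_Re; exact: (@cvg_norm _ C^o _ _ FF _ _ zl).
Qed.

Lemma cvg_realC (x : T -> R) (l : R) : x @ F --> l ->
  (fun t => ((x t)%:C)%C : C^o) @ F --> ((l%:C)%C : C^o).
Proof. by move=> xl; exact: (cvg_complex FF xl (cvg_cst 0)). Qed.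

Lemma cvg_pairing :
  (fun t => abs (pairing (a_ t) (u t) (v t)) ^+ 2) @ F --> abs (pairing a u0 v0) ^+ 2.
Proof.
have H : (fun t => abs (pairing (a_ t) (u t) (v t))) @ F --> abs (pairing a u0 v0).
  apply: cvg_abs; apply: cvg_bw_dot => //; first exact: cvg_saito_det.
  have Qc := cvg_defining_poly FF ba.
  apply: cvg_polyZ => //; apply: cvg_realC; apply: cvgV; last exact: cvg_bw_norm.
  by rewrite gt_eqF// normQ_gt0.
exact: (cvgM H H).
Qed.

Lemma cvg_total_res :
  (fun t => total_res d1 d2 (a_ t) (u t) (v t)) @ F --> total_res d1 d2 a u0 v0.
Proof. by apply: cvgD; apply: cvg_res_sqr. Qed.

Lemma cvg_denom :
  (fun t => denom d1 d2 (a_ t) beta lambda (u t) (v t)) @ F -->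
  denom d1 d2 a beta lambda u0 v0.
Proof.
apply: cvgD.
  by apply: cvg_bw_norm_sqr; exact: cvg_saito_det.
apply: (cvgM (cvg_cst _)); apply: cvg_powR => //; last exact: cvg_total_res.
- by move=> t; exact: total_res_ge0.
- exact: total_res_ge0.
Qed.

Lemma cvg_Gamma : 0 < denom d1 d2 a beta lambda u0 v0 ->
  (fun t => Gamma lambda beta (a_ t) d1 d2 (u t) (v t)) @ F -->
  Gamma lambda beta a d1 d2 u0 v0.
Proof.
move=> d0; rewrite (GammaE a1 beta lambda hu0 hv0) d0.
apply: (@cvg_trans _ ((fun t => abs (pairing (a_ t) (u t) (v t)) ^+ 2 /
    denom d1 d2 (a_ t) beta lambda (u t) (v t)) @ F)).
  apply: near_eq_cvg; near=> t.
  have b1t : forall i, form_dot (b i t) (b i t) = 1 by near: t; exact: b1.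
  rewrite (GammaE b1t beta lambda (hu t) (hv t)).
  have dt : 0 < denom d1 d2 (a_ t) beta lambda (u t) (v t).
    by near: t; exact: (cvgr_gt _ cvg_denom _ d0).
  by rewrite dt.
exact: (cvgM cvg_pairing (cvgV (lt0r_neq0 d0) cvg_denom)).
Unshelve. all: by end_near. Qed.

End GammaContinuity.

(** * Independence of the phases of the unit forms *)

Section PhaseInvariance.
Variables (R : realType) (n d1 d2 : nat) (a : 'I_n -> 'rV[R[i]]_3) (c : 'I_n -> R[i]).
Hypothesis a1 : forall i, form_dot (a i) (a i) = 1.
Hypothesis ca1 : forall i, form_dot (c i *: a i) (c i *: a i) = 1.
Local Notation C := R[i].
Local Notation ca := (fun i => c i *: a i).

Lemma phase_norm i : c i * (c i)^* = 1.
Proof.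
have := ca1 i; rewrite /form_dot.
under eq_bigr do rewrite !mxE rmorphM/= mulrACA.
by rewrite -mulr_sumr -/(form_dot _ _) a1 mulr1.
Qed.

Lemma phase_abs i : abs (c i) = 1.
Proof.
apply/eqP; rewrite -(eqrXn2 (_ : 0 < 2)%N) ?abs_ge0// expr1n; apply/eqP.
by apply: (@complexI R); rewrite rmorphXn /= absC normCK phase_norm.
Qed.

(** The form enters only through products of a coefficient and a conjugate coefficient, where the
    phases cancel. *)
Lemma perp_phase i p : perp (c i *: a i) p = perp (a i) p.
Proof.
rewrite [p]mpolyE !perp_sum; apply: eq_bigr => m _; rewrite !perpZ !perpX.
apply: (congr1 (fun q => _ *: q)); apply: eq_bigr => j _.
rewrite linformZ scalerA mxE rmorphM/= mulrAC [_^* * c i]mulrC.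
by rewrite phase_norm mul1r.
Qed.

Lemma res_sqr_phase d u : res_sqr ca d u = res_sqr a d u.
Proof.
have H i : bw_norm d (perp (c i *: a i) (contract (c i *: a i) u))
    = bw_norm d (perp (a i) (contract (a i) u)).
  have -> : contract (c i *: a i) u = c i *: contract (a i) u.
    by rewrite /contract scaler_sumr; apply: eq_bigr => j _; rewrite mxE scalerA.
  by rewrite perp_phase perpZ bw_normZ -/(abs _) phase_abs mul1r.
rewrite /res_sqr; apply: (congr1 (fun x => n%:R^-1 * x)).
by apply: eq_bigr => i _; exact: (congr1 (fun x => x ^+ 2) (H i)).
Qed.

Lemma defining_poly_phase : defining_poly ca = (\prod_i c i) *: defining_poly a.
Proof.
by rewrite /defining_poly -scaler_prod; apply: eq_bigr => i _; rewrite linformZ.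
Qed.

Lemma prod_phase_abs : abs (\prod_i c i) = 1.
Proof.
elim/big_rec: _ => [|i x _ x1]; last by rewrite absM phase_abs x1 mul1r.
by rewrite /abs normr1.
Qed.

Lemma Gamma_phase lambda beta u v : E_ d1 u -> E_ d2 v ->
  Gamma lambda beta ca d1 d2 u v = Gamma lambda beta a d1 d2 u v.
Proof.
move=> hu hv; rewrite (GammaE ca1 _ _ hu hv) (GammaE a1 _ _ hu hv).
have -> : denom d1 d2 ca beta lambda u v = denom d1 d2 a beta lambda u v.
  by rewrite /denom /total_res !res_sqr_phase.
apply: (congr1 (fun x => if _ then x ^+ 2 / _ else 0)).
rewrite /pairing /q_ defining_poly_phase bw_normZ -/(abs _) prod_phase_abs mul1r.
rewrite scalerA mulrC -scalerA [in LHS]bw_dotZr absM.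
have -> : abs ((\prod_i c i)^*) = 1 by rewrite /abs norm_conjC -/(abs _) prod_phase_abs.
by rewrite mul1r.
Qed.

End PhaseInvariance.

(** * Compactness and the configuration space *)

Section SphereCompactness.
Variables (R : realType) (d1 d2 : nat).
Local Notation C := R[i].
Local Notation S := (Spoly R).

(* Real and imaginary parts of the coefficients of a pair of derivations. *)
Local Notation coords := (prod_topology (fun _ : bool * bool * 'I_3 * multinom 3 => R)).

Definition coord (w : coords) (b : bool) (j : 'I_3) (m : multinom 3) : C :=
  (w (b, false, j, m) +i* w (b, true, j, m))%C.

Definition deriv_of (b : bool) d (w : coords) : deriv3 R :=
  \row_j \sum_(m : bmultinom 3 d.+1 | mdeg m == d) coord w b j m *: mpolyX C m.

Lemma E_deriv_of b d w : E_ d (deriv_of b d w).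
Proof.
move=> j; rewrite mxE; apply: homogeneous_sum => m; move: (val m) => {}m /eqP <-.
exact/homogeneousZ/homogeneousX.
Qed.

Lemma cvg_deriv_of b d (w0 : coords) :
  cvg_deriv (nbhs w0) (deriv_of b d) (deriv_of b d w0).
Proof.
move=> j; rewrite mxE; under [X in cvg_poly _ X]eq_fun do rewrite mxE.
apply: cvg_poly_sum => m _.
have zc : (fun w => coord w b j m : C^o) @ nbhs w0 --> (coord w0 b j m : C^o).
  apply: cvg_complex.
    exact: (@proj_continuous _ (fun=> R) (b, false, j, val m) w0).
  exact: (@proj_continuous _ (fun=> R) (b, true, j, val m) w0).
exact: (@cvg_polyZ R coords (nbhs w0) _ (fun w => coord w b j m) _
  (fun=> mpolyX C m) _ zc (@cvg_poly_cst _ _ _ _ _)).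
Qed.

Lemma deriv_of_surj (u v : deriv3 R) : sphereE R d1 u -> sphereE R d2 v ->
  exists w : coords, [/\ deriv_of true d1 w = u, deriv_of false d2 w = v &
    forall i, w i \in `[- (multinomial i.2)%:R, (multinomial i.2)%:R] ].
Proof.
move=> Su Sv; pose c b j m := mcoeff m ((if b then u else v) 0 j) : C.
pose w : coords := fun i =>
  let z := c i.1.1.1 i.1.2 i.2 in if i.1.1.2 then complex.Im z else complex.Re z.
have wE b j m : coord w b j m = c b j m.
  by rewrite /coord /w/=; case: (c b j m).
exists w; split.
- apply/rowP => j; rewrite mxE [RHS](homogeneousE (Su.1 j)).
  by apply: eq_bigr => m _; rewrite wE.
- apply/rowP => j; rewrite mxE [RHS](homogeneousE (Sv.1 j)).
  by apply: eq_bigr => m _; rewrite wE.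
move=> [[[b b'] j] m] /=; rewrite in_itv/= -ler_norml /w/=.
have : abs (c b j m) <= (multinomial m)%:R.
  by rewrite /c; case: b; apply: sphereE_coef_le; [exact: Su|exact: Sv].
by apply: le_trans; case: b'; [exact: ler_absIm|exact: ler_absRe].
Qed.

(** Continuity tested along all filters, with coefficientwise convergence in fixed degrees in place
    of a topology on derivations. *)
Definition jointly_continuous_at (f : deriv3 R -> deriv3 R -> R) (u0 v0 : deriv3 R) :=
  forall (T : Type) (F : set_system T) (u v : T -> deriv3 R), Filter F ->
    (forall t, E_ d1 (u t)) -> (forall t, E_ d2 (v t)) ->
    cvg_deriv F u u0 -> cvg_deriv F v v0 ->
    (fun t => f (u t) (v t)) @ F --> f u0 v0.

Lemma cvg_bw_normv_sqr (T : Type) (F : set_system T) (FF : Filter F) d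
    (u : T -> deriv3 R) u0 : cvg_deriv F u u0 ->
  (fun t => bw_normv d (u t) ^+ 2) @ F --> bw_normv d u0 ^+ 2.
Proof.
move=> uu0; rewrite bw_normv_sqr; under [X in X @ _]eq_fun do rewrite bw_normv_sqr.
apply: cvg_big => [|j _]; first exact: add_continuous.
exact: (cvg_bw_norm_sqr FF (uu0 j)).
Qed.

(** Meant for [f] = Gamma and [g] = the residual: [f] has to be continuous only where [r <= g], away
    from the zeros of the denominator. *)
Lemma spheres_max (f g : deriv3 R -> deriv3 R -> R) (r : R) :
  (forall u v, E_ d1 u -> E_ d2 v -> jointly_continuous_at g u v) ->
  (forall u v, E_ d1 u -> E_ d2 v -> r <= g u v -> jointly_continuous_at f u v) ->
  (exists u v, [/\ sphereE R d1 u, sphereE R d2 v & r <= g u v]) ->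
  exists u v, [/\ sphereE R d1 u, sphereE R d2 v, r <= g u v &
    forall u' v', sphereE R d1 u' -> sphereE R d2 v' -> r <= g u' v' ->
      f u' v' <= f u v].
Proof.
move=> gc fc [u1 [v1 [Su1 Sv1 ruv1]]].
pose U (w : coords) := deriv_of true d1 w; pose V (w : coords) := deriv_of false d2 w.
pose box := [set w : coords | forall i,
  `[- (multinomial i.2)%:R, (multinomial i.2)%:R]%classic (w i)].
pose K := (fun w => bw_normv d1 (U w) ^+ 2) @^-1` [set x | x = 1] `&`
  ((fun w => bw_normv d2 (V w) ^+ 2) @^-1` [set x | x = 1] `&`
   ((fun w => g (U w) (V w)) @^-1` [set x | r <= x] `&` box)).
have normE d u : E_ d u -> bw_normv d u ^+ 2 = 1 -> sphereE R d u.
  move=> hu nu; split=> //; apply/eqP; rewrite -(eqrXn2 (_ : 0 < 2)%N) ?sqrtr_ge0//.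
  by rewrite nu expr1n.
have KS w : K w -> [/\ sphereE R d1 (U w), sphereE R d2 (V w) & r <= g (U w) (V w)].
  move=> [n1 [n2 [rw _]]].
  split; [|exact: normE (@E_deriv_of _ _ _) n2|exact: rw].
  exact: normE (@E_deriv_of _ _ _) n1.
have KI u v : sphereE R d1 u -> sphereE R d2 v -> r <= g u v ->
    exists w, [/\ K w, U w = u & V w = v].
  move=> Su Sv ruv; have [w [wu wv wbox]] := deriv_of_surj Su Sv.
  exists w; split; [|exact: wu|exact: wv].
  rewrite /K /= /U /V wu wv; split; first by rewrite /= Su.2 expr1n.
  split; first by rewrite /= Sv.2 expr1n.
  split; first exact: ruv.
  exact: wbox.
(* The coordinates are indexed by all monomials, infinitely many, hence Tychonoff. *)
have box_compact : compact box.
  exact: (@tychonoff _ (fun=> R) (fun i : bool * bool * 'I_3 * multinom 3 =>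
    `[- (multinomial i.2)%:R, (multinomial i.2)%:R]%classic)
    (fun=> @segment_compact _ _ _)).
have K_compact : compact K.
  rewrite /K !setIA; apply: (subclosed_compact _ box_compact); last by move=> w [].
  have box_closed : closed box.
    rewrite (_ : box = \bigcap_i ((fun w : coords => w i) @^-1`
        `[- (multinomial i.2)%:R, (multinomial i.2)%:R]%classic)); last first.
      by apply/seteqP; split=> [w wb i _|w wb i]; [exact: wb|exact: (wb i Logic.I)].
    apply: closed_bigI => i _; apply: preimage_closed; last exact: interval_closed.
    by move=> w _; exact: (@proj_continuous _ (fun=> R) i w).
  apply: closedI box_closed; apply: closedI.
    apply: closedI.
      apply: preimage_closed; last exact: closed_eq.
      move=> w _; exact: (@cvg_bw_normv_sqr coords (nbhs w) _ d1 U (U w)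
        (@cvg_deriv_of true d1 w)).
    apply: preimage_closed; last exact: closed_eq.
    move=> w _; exact: (@cvg_bw_normv_sqr coords (nbhs w) _ d2 V (V w)
      (@cvg_deriv_of false d2 w)).
  apply: preimage_closed; last exact: closed_ge.
  move=> w _; exact: (gc (U w) (V w) (@E_deriv_of _ _ w) (@E_deriv_of _ _ w) coords
    (nbhs w) U V _ (@E_deriv_of _ _) (@E_deriv_of _ _) (@cvg_deriv_of true d1 w)
    (@cvg_deriv_of false d2 w)).
have [w1 [Kw1 _ _]] := KI _ _ Su1 Sv1 ruv1.
have [|w /set_mem Kw wmax] := @compact_EVT_max coords R (fun w => f (U w) (V w)) K
    (ex_intro _ w1 Kw1) K_compact.
  apply: continuous_in_subspaceT => w /set_mem /KS[_ _ rw].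
  exact: (fc (U w) (V w) (@E_deriv_of _ _ w) (@E_deriv_of _ _ w) rw coords
    (nbhs w) U V _ (@E_deriv_of _ _) (@E_deriv_of _ _) (@cvg_deriv_of true d1 w)
    (@cvg_deriv_of false d2 w)).
have [SUw SVw rw] := KS w Kw; exists (U w), (V w); split=> //.
move=> u' v' Su' Sv' ruv'; have [w' [Kw' <- <-]] := KI _ _ Su' Sv' ruv'.
exact/wmax/mem_set.
Qed.

End SphereCompactness.

(** * A locally continuous choice of unit forms *)

Section ConfigurationContinuity.
Variable R : realType.
Local Notation C := R[i].
Implicit Types (a b : 'rV[C]_3).

Lemma form_dot_conj a b : (form_dot a b)^* = form_dot b a.
Proof. by rewrite -!bw_dot_linform bw_dot_conj. Qed.

Lemma form_dotZr (c : C) a b : form_dot a (c *: b) = c^* * form_dot a b.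
Proof. by rewrite -form_dot_conj form_dotZl rmorphM/= form_dot_conj. Qed.

Lemma form_dot_neq0 a : a != 0 -> form_dot a a != 0.
Proof.
move=> a0; rewrite -bw_dot_linform; apply: contra a0 => /eqP H.
by rewrite -linform_eq0; apply/eqP; apply: bw_dot_eq0 H; exact: homogeneous_linform.
Qed.

Definition unitize a : 'rV[C]_3 := (((bw_norm 1 (linform a))^-1)%:C)%C *: a.

Lemma bw_norm_linform_gt0 a : a != 0 -> 0 < bw_norm 1 (linform a).
Proof.
by move=> a0; apply: bw_norm_gt0; [exact: homogeneous_linform|rewrite linform_eq0].
Qed.

Lemma form_dot_unitize a : a != 0 -> form_dot (unitize a) (unitize a) = 1.
Proof.
move=> a0; rewrite form_dotZl form_dotZr -bw_dot_linform -bw_norm_sqrC.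
have := bw_norm_linform_gt0 a0; move: (bw_norm _ _) => x x0.
by rewrite conj_realC -!rmorphM/= mulrA -expr2 -exprMn mulVf ?gt_eqF// expr1n.
Qed.

(* The orthogonal projection of [a0] on the line spanned by [a] depends only on
   this line: near the class of [a0], it is a continuous choice of a nonzero
   representative. *)
Definition line_proj (a0 a : 'rV[C]_3) : 'rV[C]_3 :=
  (form_dot a0 a / form_dot a a) *: a.

Lemma line_projZ a0 a (c : C) : c != 0 -> a != 0 ->
  line_proj a0 (c *: a) = line_proj a0 a.
Proof.
move=> c0 a_neq0; have g0 := form_dot_neq0 a_neq0.
have cc0 : c^* != 0 by rewrite conjC_eq0.
rewrite /line_proj form_dotZl !form_dotZr scalerA; congr (_ *: _).
move: (form_dot a0 a) (form_dot a a) (c^*) g0 cc0 => f g k g0 k0.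
by field; rewrite g0 k0 c0.
Qed.

Lemma line_proj_id a : a != 0 -> line_proj a a = a.
Proof. by move=> a0; rewrite /line_proj divff ?form_dot_neq0// scale1r. Qed.

Lemma coef_continuous j :
  continuous (fun a : @nonzero_form R => (set_val a : 'rV[C]_3) 0 j : C^o).
Proof.
move=> a; apply: (@continuous_comp _ _ _ set_val (fun M : 'rV[C^o]_3 => M 0 j)).
  exact: initial_continuous.
exact: (@coord_continuous C 1 3 0 j).
Qed.

Lemma line_proj_continuous a0 j :
  continuous ((fun a : @nonzero_form R => line_proj a0 (set_val a) 0 j : C^o)
    \o repr : projS1 R -> C^o).
Proof.
(* The function is invariant under rescaling, so it descends to the quotient, and its continuity is
   checked on nonzero vectors. *)
apply: repr_comp_continuous => [a|a b /eqP/eqmodP/asboolP[c c0 ab]]; last first.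
  have b0 : set_val b != 0 :> 'rV[C]_3 by have := set_valP b.
  by rewrite ab line_projZ.
have FF := nbhs_filter a.
have a0' : set_val a != 0 :> 'rV[C]_3 by have := set_valP a.
have dotc (p : @nonzero_form R -> 'rV[C]_3) (l : 'rV[C]_3) :
    (forall k, (fun x => p x 0 k : C^o) @ nbhs a --> (l 0 k : C^o)) ->
    (fun x => form_dot (p x) (set_val x) : C^o) @ nbhs a -->
    (form_dot l (set_val a) : C^o).
  move=> pl; apply: cvg_sumC => k _.
  by apply: (cvgM (pl k)); apply: cvg_conj; exact: coef_continuous.
rewrite /continuous_at /line_proj mxE; under [X in X @ _]eq_fun do rewrite mxE.
apply: cvgM; last exact: coef_continuous.
apply: cvgM; first by apply: dotc => k; exact: cvg_cst.
apply: cvgV; first exact: form_dot_neq0.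
by apply: dotc => k; exact: coef_continuous.
Qed.

Variable n : nat.
Implicit Types A : U_ R n.

Lemma line_continuous i : continuous (fun A : U_ R n => line A i).
Proof.
move=> A; apply: (@continuous_comp _ _ _ set_val
  (fun f : {ptws 'I_n -> projS1 R} => f i)).
  exact: initial_continuous.
exact: (@proj_continuous _ (fun=> projS1 R) i).
Qed.

Definition rep A i : 'rV[C]_3 := set_val (repr (line A i)).

Lemma rep_neq0 A i : rep A i != 0.
Proof. exact: (set_valP (repr (line A i))). Qed.

Lemma unit_formsE A i : unit_forms A i = unitize (rep A i).
Proof. by []. Qed.

Lemma unit_forms_unit A i : form_dot (unit_forms A i) (unit_forms A i) = 1.
Proof. by rewrite unit_formsE form_dot_unitize// rep_neq0. Qed.

Lemma unit_forms_inj A i j (c : C) :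
  unit_forms A i = c *: unit_forms A j -> i = j.
Proof.
move=> E0; pose k i : C := (((bw_norm 1 (linform (rep A i)))^-1)%:C)%C.
pose x := k i; pose y := k j.
have E : x *: rep A i = c *: (y *: rep A j) := E0.
have x0 : x != 0 by rewrite realC_eq0 invr_eq0 gt_eqF// bw_norm_linform_gt0// rep_neq0.
have rE : rep A i = (x^-1 * (c * y)) *: rep A j.
  by rewrite -scalerA -[(c * y) *: _]scalerA -E scalerA mulVf// scale1r.
have inj : injective (set_val A : 'I_n -> projS1 R) by exact: set_valP A.
apply: inj; rewrite -/(line A i) -/(line A j) -[line A i]reprK -[line A j]reprK.
apply/eqmodP/asboolP; exists (x^-1 * (c * y)); last exact: rE.
by apply: contraNneq (rep_neq0 A i) => k0; rewrite rE k0 scale0r.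
Qed.

(** Unit forms of [A] whose phases are aligned with those of [A0]. The projection is zero when the
    two lines have orthogonal forms, so these are unit forms only near [A0]. *)
Definition local_forms (A0 A : U_ R n) (i : 'I_n) : 'rV[C]_3 :=
  unitize (line_proj (unit_forms A0 i) (rep A i)).

Lemma local_forms_phase A0 A : exists c : 'I_n -> C,
  local_forms A0 A = fun i => c i *: unit_forms A i.
Proof.
pose x i := bw_norm 1 (linform (rep A i)).
pose y i := (((bw_norm 1 (linform (line_proj (unit_forms A0 i) (rep A i))))^-1)%:C)%C : C.
pose z i := form_dot (unit_forms A0 i) (rep A i) / form_dot (rep A i) (rep A i).
exists (fun i => y i * z i * ((x i)%:C)%C); apply/funext => i.
rewrite unit_formsE /unitize scalerA -mulrA -rmorphM /= mulfV ?gt_eqF//.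
  by rewrite mulr1 -scalerA.
exact/bw_norm_linform_gt0/rep_neq0.
Qed.

Lemma cvg_line_proj A0 i : cvg_vec (nbhs A0)
  (fun A => line_proj (unit_forms A0 i) (rep A i)) (unit_forms A0 i).
Proof.
move=> j.
have E : unit_forms A0 i = line_proj (unit_forms A0 i) (rep A0 i).
  rewrite {2}unit_formsE.
  rewrite -(line_projZ _ (c := (((bw_norm 1 (linform (rep A0 i)))^-1)%:C)%C)).
  - rewrite -[_ *: rep _ _]unit_formsE line_proj_id//.
    exact: (@unit_form_neq0 _ n _ (unit_forms_unit A0)).
  - by rewrite realC_eq0 invr_eq0 gt_eqF// bw_norm_linform_gt0// rep_neq0.
  - exact: rep_neq0.
rewrite [in X in _ --> X]E.
pose g (P : projS1 R) : C^o := line_proj (unit_forms A0 i) (set_val (repr P)) 0 j.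
have gc : continuous g by exact: line_proj_continuous.
exact: (@continuous_comp _ _ _ (fun A : U_ R n => line A i) g A0
  (@line_continuous i A0) (gc _)).
Qed.

Lemma cvg_norm_line_proj A0 i :
  (fun A => bw_norm 1 (linform (line_proj (unit_forms A0 i) (rep A i)))) @ nbhs A0
  --> (1 : R).
Proof.
have n1 : bw_norm 1 (linform (unit_forms A0 i)) = 1.
  apply/eqP; rewrite -(eqrXn2 (_ : 0 < 2)%N) ?sqrtr_ge0// expr1n; apply/eqP.
  by apply: (@complexI R); rewrite bw_norm_sqrC bw_dot_linform unit_forms_unit.
rewrite -n1; apply: cvg_bw_norm; apply: cvg_linform; exact: cvg_line_proj.
Qed.

Lemma cvg_local_forms A0 i :
  cvg_vec (nbhs A0) (fun A => local_forms A0 A i) (unit_forms A0 i).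
Proof.
move=> j; have pj := @cvg_line_proj A0 i j.
have nc : (fun A => (((bw_norm 1
    (linform (line_proj (unit_forms A0 i) (rep A i))))^-1)%:C)%C : C^o) @ nbhs A0
    --> ((((1 : R)^-1)%:C)%C : C^o).
  by apply: cvg_realC; apply: cvgV; [exact: oner_neq0|exact: cvg_norm_line_proj].
have -> : unit_forms A0 i 0 j = (((1 : R)^-1)%:C)%C * unit_forms A0 i 0 j.
  by rewrite invr1 mul1r.
rewrite /local_forms /unitize; under [X in X @ _]eq_fun do rewrite mxE.
exact: (cvgM nc pj).
Qed.

Lemma local_forms_unit A0 : \forall A \near A0, forall i,
  form_dot (local_forms A0 A i) (local_forms A0 A i) = 1.
Proof.
have H : \forall A \near A0, forall i,
    0 < bw_norm 1 (linform (line_proj (unit_forms A0 i) (rep A i))).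
  exact: (@filter_forall _ _ (fun i A =>
      0 < bw_norm 1 (linform (line_proj (unit_forms A0 i) (rep A i)))) _
    (nbhs_filter A0) (fun i => cvgr_gt _ (@cvg_norm_line_proj A0 i) _ (@ltr01 R))).
apply: filterS H => A HA i; apply: form_dot_unitize.
by apply: contraTneq (HA i) => ->; rewrite linform0 /bw_norm bw_dot0l sqrtr0 ltxx.
Qed.

Lemma Gamma_config_continuous (d1 d2 : nat) (beta lambda : R) A0 (u v : deriv3 R) :
  0 < beta -> E_ d1 u -> E_ d2 v ->
  0 < denom d1 d2 (unit_forms A0) beta lambda u v ->
  (fun A => Gamma lambda beta (unit_forms A) d1 d2 u v) @ nbhs A0 -->
  Gamma lambda beta (unit_forms A0) d1 d2 u v.
Proof.
move=> b0 hu hv d0.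
have H : (fun A => Gamma lambda beta (local_forms A0 A) d1 d2 u v) @ nbhs A0 -->
    Gamma lambda beta (unit_forms A0) d1 d2 u v.
  have FF := nbhs_filter A0.
  apply: (@cvg_Gamma R (U_ R n) (nbhs A0) FF n d1 d2 (unit_forms A0)
    (fun i A => local_forms A0 A i) (unit_forms_unit A0) (local_forms_unit A0)
    (@cvg_local_forms A0) (fun=> u) (fun=> v) u v (fun=> hu) (fun=> hv) hu hv) => //.
  - by move=> j; exact: cvg_poly_cst.
  - by move=> j; exact: cvg_poly_cst.
(* Near [A0] both choices of unit forms differ by phases only, which Gamma does not see. *)
apply: cvg_trans H; apply: near_eq_cvg; near=> A.
have lu : forall i, form_dot (local_forms A0 A i) (local_forms A0 A i) = 1.
  by near: A; exact: local_forms_unit.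
have [c cE] := local_forms_phase A0 A; rewrite cE.
apply: (Gamma_phase (unit_forms_unit A)) => // i.
by have := lu i; rewrite cE.
Unshelve. all: by end_near. Qed.

End ConfigurationContinuity.

(** * The Saito functional *)

Section SaitoFunctionalTheory.
Variables (R : realType) (n d1 d2 : nat) (beta : R).
Hypothesis nE : (d1 + d2 + 1)%N = n.
Hypotheses (beta0 : 0 < beta) (beta1 : beta < 1).
Local Notation C := R[i].
Implicit Types (A : U_ R n) (u v : deriv3 R) (lambda mu : R).
Local Notation Gam lambda A u v := (Gamma lambda beta (unit_forms A) d1 d2 u v).
Local Notation num A u v := (abs (pairing (unit_forms A) u v) ^+ 2).
Local Notation den A lambda u v := (denom d1 d2 (unit_forms A) beta lambda u v).
Local Notation res A u v := (total_res d1 d2 (unit_forms A) u v).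

Lemma num_le_den A lambda u v : 0 <= lambda -> num A u v <= den A lambda u v.
Proof. by move=> l0; apply: denom_ge => //; exact: unit_forms_unit. Qed.

Lemma den_ge0 A lambda u v : 0 <= lambda -> 0 <= den A lambda u v.
Proof. by move=> l0; apply: le_trans (num_le_den A u v l0); exact: sqr_ge0. Qed.

(** Division by zero gives 0, in agreement with the convention for a zero denominator. *)
Lemma Gamma_ratio A lambda u v : 0 <= lambda -> E_ d1 u -> E_ d2 v ->
  Gam lambda A u v = num A u v / den A lambda u v.
Proof.
move=> l0 hu hv; rewrite (GammaE (unit_forms_unit A) beta lambda hu hv).
case: ltP => // d0; have /eqP -> : den A lambda u v == 0 by rewrite eq_le d0 den_ge0.
by rewrite invr0 mulr0.
Qed.

Lemma Gamma_le A lambda u v (x : R) : 0 <= lambda -> E_ d1 u -> E_ d2 v ->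
  0 <= x -> num A u v <= x * den A lambda u v -> Gam lambda A u v <= x.
Proof.
move=> l0 hu hv x0 H; rewrite Gamma_ratio//.
have [d0|] := ltP 0 (den A lambda u v); first by rewrite ler_pdivrMr.
move=> d0; have /eqP -> : den A lambda u v == 0 by rewrite eq_le d0 den_ge0.
by rewrite invr0 mulr0.
Qed.

Lemma Gamma_in01 A lambda u v : 0 <= lambda -> E_ d1 u -> E_ d2 v ->
  0 <= Gam lambda A u v <= 1.
Proof.
move=> l0 hu hv; rewrite (Gamma_ge0 (unit_forms_unit A) beta lambda hu hv).
by rewrite (Gamma_le1 (unit_forms_unit A) beta l0 hu hv).
Qed.

Lemma res_le_den A lambda u v : lambda * res A u v `^ beta <= den A lambda u v.
Proof. by rewrite lerDr sqr_ge0. Qed.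

Lemma Gamma_antitone A lambda mu u v : 0 < lambda -> lambda <= mu ->
  E_ d1 u -> E_ d2 v -> Gam mu A u v <= Gam lambda A u v.
Proof.
move=> l0 lm hu hv; have m0 := lt_le_trans l0 lm.
have /andP[G0 _] := Gamma_in01 A (ltW l0) hu hv.
apply: Gamma_le => //; first exact: ltW.
(* A vanishing denominator forces the numerator to vanish. *)
have [d0|d0] := ltP 0 (den A lambda u v); last first.
  apply: le_trans (num_le_den A u v (ltW l0)) _; apply: le_trans d0 _.
  by rewrite mulr_ge0// den_ge0// ltW.
rewrite (Gamma_ratio A (ltW l0) hu hv) [leRHS]mulrAC ler_pdivlMr//.
apply: ler_wpM2l; first exact: sqr_ge0.
by rewrite lerD2l ler_wpM2r// powR_ge0.
Qed.

(** Both bounds of [pairing_bound] are compared with the penalty term of the denominator, after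
    splitting the residual as its power [1 - beta] times its power [beta]. *)
Lemma nonfree_Gamma_le A : ~ free_with_exponents A d1 d2 ->
  exists2 M : R, 0 < M & forall lambda u v, 0 < lambda ->
    sphereE R d1 u -> sphereE R d2 v ->
    Gam lambda A u v <= M / lambda /\
    Gam lambda A u v <= M / lambda * res A u v `^ (1 - beta).
Proof.
move=> nf; have [M M0 HM] := pairing_bound nE (unit_forms_unit A)
  (@unit_forms_inj R n A) beta0 beta1 nf.
exists M => // lambda u v l0 Su Sv; have [H1 H2] := HM u v Su Sv.
have r0 : 0 <= res A u v by exact: total_res_ge0.
have l0' := ltW l0; have Ml : 0 <= M / lambda by rewrite divr_ge0 ?ltW.
have E : M * res A u v `^ beta = M / lambda * (lambda * res A u v `^ beta).
  by rewrite mulrA divfK// gt_eqF.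
split; apply: (Gamma_le l0' Su.1 Sv.1) => //.
- by apply: le_trans H2 _; rewrite E; apply: (ler_wpM2l Ml); exact: res_le_den.
- by rewrite mulr_ge0// powR_ge0.
have rE : res A u v = res A u v `^ (1 - beta) * res A u v `^ beta.
  by rewrite -powRD ?subrK ?oner_eq0// powRr1.
apply: le_trans H1 _; rewrite {1}rE.
have -> : M * (res A u v `^ (1 - beta) * res A u v `^ beta) =
    M / lambda * res A u v `^ (1 - beta) * (lambda * res A u v `^ beta).
  by move: (_ `^ (1 - beta)) (_ `^ beta) => x y; field; rewrite gt_eqF.
by apply: ler_wpM2l; [rewrite mulr_ge0// powR_ge0|exact: res_le_den].
Qed.

Lemma Gamma_max A lambda : 0 < lambda -> exists u v,
  [/\ sphereE R d1 u, sphereE R d2 v & forall u' v',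
    sphereE R d1 u' -> sphereE R d2 v' -> Gam lambda A u' v' <= Gam lambda A u v].
Proof.
move=> l0; have a1 := unit_forms_unit A; have aI := @unit_forms_inj R n A.
have [/(free_Gamma_eq1 nE a1 aI beta0)[u [v [Su Sv G1]]]|nf] :=
    pselect (free_with_exponents A d1 d2).
  exists u, v; split; [exact: Su|exact: Sv|move=> u' v' Su' Sv'].
  have G1' : 1 <= Gam lambda A u v by rewrite G1.
  have /andP[_ G1''] := Gamma_in01 A (ltW l0) Su'.1 Sv'.1.
  exact: le_trans G1'' G1'.
have [u1 [v1 [Su1 Sv1 G0]]] := Gamma_gt0 nE a1 beta.
have {}G0 := G0 lambda l0; set g1 := Gam lambda A u1 v1 in G0.
have [M M0 HM] := nonfree_Gamma_le nf.
have b1 : 0 < 1 - beta by rewrite subr_gt0.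
pose s := g1 * lambda / M; have s0 : 0 < s by rewrite divr_gt0// mulr_gt0.
pose r := s `^ (1 - beta)^-1; have r0 : 0 < r by exact: powR_gt0.
have small u v : sphereE R d1 u -> sphereE R d2 v -> res A u v < r ->
    Gam lambda A u v < g1.
  move=> Su Sv rr; apply: le_lt_trans (HM lambda u v l0 Su Sv).2 _.
  have : res A u v `^ (1 - beta) < s.
    have -> : s = r `^ (1 - beta) by rewrite /r -powRrM mulVf ?gt_eqF// powRr1// ltW.
    by apply: gt0_ltr_powR => //; rewrite nnegrE ?total_res_ge0// ltW.
  rewrite /s ltr_pdivlMr// => H.
  by rewrite mulrAC ltr_pdivrMr// mulrC.
have [u v hu hv|u v hu hv ruv||u [v [Su Sv ruv uvmax]]] := @spheres_max R d1 d2
    (fun u v => Gam lambda A u v) (fun u v => res A u v) r.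
- move=> T F u' v' FF hu' hv' uu' vv'.
  apply: (@cvg_total_res R T F FF n d1 d2 (unit_forms A)
    (fun i _ => unit_forms A i)) => //.
  by move=> i j; exact: cvg_cst.
- move=> T F u' v' FF hu' hv' uu' vv'.
  have d0 : 0 < den A lambda u v.
    apply: lt_le_trans (res_le_den A lambda u v).
    by rewrite mulr_gt0// powR_gt0// (lt_le_trans r0).
  apply: (@cvg_Gamma R T F FF n d1 d2 (unit_forms A)
    (fun i _ => unit_forms A i)) => //.
  - exact: nearW.
  - by move=> i j; exact: cvg_cst.
- exists u1, v1; split; [exact: Su1|exact: Sv1|rewrite leNgt].
  apply/negP => /(small _ _ Su1 Sv1).
  by rewrite ltxx.
exists u, v; split; [exact: Su|exact: Sv|move=> u' v' Su' Sv'].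
have [|r'] := leP r (res A u' v'); first exact: uvmax.
apply/ltW/(lt_le_trans (small _ _ Su' Sv' r')); apply: (uvmax _ _ Su1 Sv1).
by rewrite leNgt; apply/negP => /(small _ _ Su1 Sv1); rewrite ltxx.
Qed.

Lemma saito_max A lambda : 0 < lambda -> exists u v,
  [/\ sphereE R d1 u, sphereE R d2 v,
      forall u' v', sphereE R d1 u' -> sphereE R d2 v' ->
        Gam lambda A u' v' <= Gam lambda A u v
    & saito lambda beta A d1 d2 = 1 - Gam lambda A u v].
Proof.
move=> l0; have [u [v [Su Sv uvmax]]] := Gamma_max A l0.
exists u, v; split; [exact: Su|exact: Sv|exact: uvmax|].
rewrite /saito; congr (1 - _); set G := [set _ | _ in _].
have Guv : G (Gam lambda A u v) by exists (u, v).
have Gub : ubound G (Gam lambda A u v).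
  by move=> _ [[u' v'] [Su' Sv'] <-]; exact: uvmax.
apply/eqP; rewrite eq_le; apply/andP; split.
  by apply: ge_sup => //; exists (Gam lambda A u v).
by apply: ub_le_sup => //; exists (Gam lambda A u v).
Qed.

Lemma saito_le A lambda u v : 0 < lambda -> sphereE R d1 u -> sphereE R d2 v ->
  saito lambda beta A d1 d2 <= 1 - Gam lambda A u v.
Proof.
move=> l0 Su Sv; have [u' [v' [_ _ H ->]]] := saito_max A l0.
by rewrite lerD2l lerN2; exact: H.
Qed.

Lemma saito_in01 A lambda : 0 < lambda -> 0 <= saito lambda beta A d1 d2 <= 1.
Proof.
move=> l0; have [u [v [Su Sv _ ->]]] := saito_max A l0.
have /andP[G0 G1] := Gamma_in01 A (ltW l0) Su.1 Sv.1.
by rewrite subr_ge0 G1 gerBl G0.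
Qed.

Lemma saito_eq0 A lambda : 0 < lambda ->
  saito lambda beta A d1 d2 = 0 <-> free_with_exponents A d1 d2.
Proof.
move=> l0; have a1 := unit_forms_unit A; have aI := @unit_forms_inj R n A; split.
  have [u [v [Su Sv _ ->]]] := saito_max A l0 => /eqP.
  rewrite subr_eq0 eq_sym => /eqP.
  exact: (Gamma_eq1_free nE a1 aI beta0 l0 Su.1 Sv.1).
move=> /(free_Gamma_eq1 nE a1 aI beta0)[u [v [Su Sv G1]]].
have /andP[s0 _] := saito_in01 A l0.
apply/eqP; rewrite eq_le s0 andbT.
by have := saito_le A l0 Su Sv; rewrite G1 subrr.
Qed.

Lemma saito_lt1 A lambda : 0 < lambda -> saito lambda beta A d1 d2 < 1.
Proof.
move=> l0; have [u [v [Su Sv G0]]] := Gamma_gt0 nE (unit_forms_unit A) beta.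
by apply: le_lt_trans (saito_le A l0 Su Sv) _; rewrite gtrBl G0.
Qed.

Lemma saito_usc lambda : 0 < lambda ->
  upper_semicontinuous (fun A : U_ R n => saito lambda beta A d1 d2).
Proof.
(* For [x > 1] the bound by 1 suffices. For [x <= 1] the maximum exceeds [1 - x >= 0], so the
   denominator at the maximizing pair is positive and Gamma is continuous in [A] there. *)
move=> l0 A x; have [x1|x1] := ltP 1 x => Ax.
  apply: (@filterE _ (nbhs A) (nbhs_filter A)) => A'; apply: le_lt_trans x1.
  by have /andP[] := saito_in01 A' l0.
have [u [v [Su Sv _ sE]]] := saito_max A l0.
have Gx : 1 - x < Gam lambda A u v by rewrite ltrBlDr addrC -ltrBlDr -sE.
have d0 : 0 < den A lambda u v.
  rewrite lt_neqAle den_ge0 ?ltW// andbT eq_sym.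
  apply: contraTneq Gx => d0; rewrite (Gamma_ratio A (ltW l0) Su.1 Sv.1) d0 invr0 mulr0.
  by rewrite -leNgt subr_ge0.
have H : \forall A' \near A, 1 - x < Gam lambda A' u v.
  exact: (cvgr_gt _ (Gamma_config_continuous beta0 Su.1 Sv.1 d0) _ Gx).
apply: filterS H => A' GA'; apply: le_lt_trans (saito_le A' l0 Su Sv) _.
by rewrite ltrBlDr addrC -ltrBlDr.
Qed.

(** The value 0 is the minimum, so lower semicontinuity is automatic there. *)
Lemma saito_continuous_at_free lambda A : 0 < lambda ->
  free_with_exponents A d1 d2 ->
  {for A, continuous (fun A' : U_ R n => saito lambda beta A' d1 d2)}.
Proof.
move=> l0 /(saito_eq0 A l0) s0.
apply/(cvgrPdist_lt (FF := nbhs_filter A)) => e e0.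
have H : \forall A' \near A, saito lambda beta A' d1 d2 < e.
  by apply: (saito_usc l0); rewrite s0.
apply: filterS H => A' A'e; rewrite s0 sub0r normrN ger0_norm//.
by have /andP[] := saito_in01 A' l0.
Qed.

Lemma saito_nondecreasing A lambda mu : 0 < lambda -> lambda <= mu ->
  saito lambda beta A d1 d2 <= saito mu beta A d1 d2.
Proof.
move=> l0 lm; have [u [v [Su Sv _ ->]]] := saito_max A (lt_le_trans l0 lm).
apply: le_trans (saito_le A l0 Su Sv) _.
by rewrite lerD2l lerN2; exact: (Gamma_antitone A l0 lm Su.1 Sv.1).
Qed.

Lemma saito_free_limit A : free_with_exponents A d1 d2 ->
  saito lambda beta A d1 d2 @[lambda --> +oo] --> (0 : R).
Proof.
move=> fA; apply/cvgrPdist_lt => e e0; near=> lambda.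
have l0 : 0 < lambda by near: lambda; exact: nbhs_pinfty_gt.
by rewrite (saito_eq0 A l0).2// subrr normr0.
Unshelve. all: by end_near. Qed.

Lemma saito_nonfree_limit A : ~ free_with_exponents A d1 d2 ->
  saito lambda beta A d1 d2 @[lambda --> +oo] --> (1 : R).
Proof.
move=> /nonfree_Gamma_le[M M0 HM]; apply/cvgrPdist_lt => e e0; near=> lambda.
have l0 : 0 < lambda by near: lambda; exact: nbhs_pinfty_gt.
have lM : M / e < lambda by near: lambda; apply: nbhs_pinfty_gt; exact: num_real.
have [u [v [Su Sv _ ->]]] := saito_max A l0.
have /andP[G0 _] := Gamma_in01 A (ltW l0) Su.1 Sv.1.
rewrite opprB addrC subrK ger0_norm//.
apply: le_lt_trans (HM lambda u v l0 Su Sv).1 _.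
by rewrite ltr_pdivrMr// mulrC -ltr_pdivrMr.
Unshelve. all: by end_near. Qed.

End SaitoFunctionalTheory.

Theorem theorem3 (R : realType) (n d1 d2 : nat) (hn : (d1 + d2 + 1 = n)%N)
    (beta : R) (hbeta0 : 0 < beta) (hbeta1 : beta < 1) :
  (forall lambda : R, 0 < lambda ->
    [/\
      forall A : U_ R n,
        0 <= saito lambda beta A d1 d2 <= 1 /\
        (exists u v : deriv3 R,
          [/\ sphereE R d1 u, sphereE R d2 v,
              forall u' v', sphereE R d1 u' -> sphereE R d2 v' ->
                Gamma lambda beta (unit_forms A) d1 d2 u' v'
                <= Gamma lambda beta (unit_forms A) d1 d2 u v
            & saito lambda beta A d1 d2
              = 1 - Gamma lambda beta (unit_forms A) d1 d2 u v]),
      forall A : U_ R n,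
        saito lambda beta A d1 d2 = 0 <-> free_with_exponents A d1 d2,
      forall A : U_ R n, ~ free_with_exponents A d1 d2 ->
        0 < saito lambda beta A d1 d2 < 1
    & upper_semicontinuous (fun A : U_ R n => saito lambda beta A d1 d2) /\
      (forall A : U_ R n, free_with_exponents A d1 d2 ->
        {for A, continuous (fun A' : U_ R n => saito lambda beta A' d1 d2)})]) /\
  (forall A : U_ R n,
    [/\ forall lambda mu : R, 0 < lambda -> lambda <= mu ->
          saito lambda beta A d1 d2 <= saito mu beta A d1 d2,
        free_with_exponents A d1 d2 ->
          saito lambda beta A d1 d2 @[lambda --> +oo] --> (0 : R)
      & ~ free_with_exponents A d1 d2 ->
          saito lambda beta A d1 d2 @[lambda --> +oo] --> (1 : R)]).
Proof.
split=> [lambda lambda0|A]; last first.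
  split=> [lambda mu lambda0 le_mu|freeA|nfreeA].
  - exact: (saito_nondecreasing hn hbeta0 hbeta1).
  - exact: (saito_free_limit hn hbeta0 hbeta1).
  - exact: (saito_nonfree_limit hn hbeta0 hbeta1).
split.
- move=> A; split; first exact: (saito_in01 hn hbeta0 hbeta1).
  exact: (saito_max hn hbeta0 hbeta1).
- by move=> A; exact: (saito_eq0 hn hbeta0 hbeta1).
- move=> A nfreeA; rewrite (saito_lt1 hn hbeta0 hbeta1 A lambda0) andbT.
  have /andP[s0 _] := saito_in01 hn hbeta0 hbeta1 A lambda0.
  rewrite lt_neqAle s0 andbT eq_sym; apply/eqP => sE; apply: nfreeA.
  exact: (saito_eq0 hn hbeta0 hbeta1 A lambda0).1 sE.
- split; first exact: (saito_usc hn hbeta0 hbeta1).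
  by move=> A freeA; exact: (saito_continuous_at_free hn hbeta0 hbeta1).
Qed.
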